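(* Assume that $F(x)=\mathbb{E}_{z\sim p(z;x)}[\tilde F(x;z)]$ satisfies the assumptions (A1)–(A4) listed in the context, and that $F$ is monotone and continuous DR-submodular on the positive orthant. Run the maximization version of the algorithm 1-SFW described in the context (with the exact Hessian estimator) for $T$ iterations with $x_1=0\in\mathcal{K}$, $\rho_t=(t-1)^{-1}$ (for $t\ge2$) and $\eta_t=T^{-1}$. Then the output $x_{T+1}$ belongs to $\mathcal{K}$ and $$\mathbb{E}[F(x_{T+1})]\ge(1-e^{-1})F(x^* )-\frac{4R\sqrt{C}}{T^{1/2}}-\frac{\bar LR^2}{2T},$$ where $C=\max\{4(2G+R\bar L)^2,\ 256,\ [2R(\bar L+L)]^4\}$ and $x^*$ is a maximizer of $F$ on $\mathcal{K}$.
   Context: Norms are Euclidean for vectors and spectral for matrices; gradients and Hessians are with respect to $x$. $\mathcal{K}\subseteq[0,\infty)^d$ is convex, $\mathcal{Z}$ is a sample space, $p(\cdot\,;x)$ is a probability distribution (density) on $\mathcal{Z}$ depending on $x$, $\tilde F:\mathbb{R}^d\times\mathcal{Z}\to\mathbb{R}$, and $F(x)=\mathbb{E}_{z\sim p(z;x)}[\tilde F(x;z)]$. DR-submodularity: inequalities between vectors are coordinatewise. A continuous, nonnegative function $F$ is (continuous) DR-submodular on the positive orthant if it is differentiable there and $\nabla F(x)\ge\nabla F(y)$ whenever $x\le y$; it is monotone if $F(x)\le F(y)$ whenever $x\le y$. Assumptions: (A1) $\mathcal{K}$ is compact with radius $R=\max_{x\in\mathcal{K}}\|x\|$. (A2)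 $|\tilde F(x;z)|\le B$ for all $x\in\mathcal{K},z\in\mathcal{Z}$. (A3) $\|\nabla\tilde F(x;z)\|\le G_{\tilde F}$ for all $x\in\mathcal{K},z\in\mathcal{Z}$, and $\mathbb{E}_{z\sim p(z;x)}\|\nabla\log p(z;x)\|^4\le G_p^4$ for all $x\in\mathcal K$; set $G=\max\{G_{\tilde F},G_p\}$. (A4) $\|\nabla^2\tilde F(x;z)\|\le L_{\tilde F}$ for all $x\in\mathcal{K},z\in\mathcal{Z}$, and $\mathbb{E}_{z\sim p(z;x)}\|\nabla^2\log p(z;x)\|^2\le L_p^2$ for all $x\in\mathcal K$; set $L=\max\{L_{\tilde F},L_p\}$. Standing convention: the stochastic gradient is unbiased, $\mathbb{E}_{z\sim p(z;x)}[\nabla\tilde F(x;z)]=\nabla F(x)$. Define $\bar L\ge 0$ by $\bar L^2=4B^2G^4+16G^4+4L^2+4B^2L^2$. Hessian estimator (unbiased for $\nabla^2F(x)$ when $z\sim p(z;x)$): $$\tilde\nabla^2F(x;z)=\tilde F(x;z)[\nabla\log p(z;x)][\nabla\log p(z;x)]^\top+\nabla^2\tilde F(x;z)+[\nabla\tilde F(x;z)][\nabla\log p(z;x)]^\top+\tilde F(x;z)\nabla^2\log p(z;x)+[\nabla\log p(z;x)][\nabla\tilde F(x;z)]^\top.$$ Algorithm 1-SFW (exact Hessian option, DR-submodular maximization version): for $t=1,\dots,T$: if $t=1$, sample $z_1\sim p(z;x_1)$ and set $d_1=\nabla\tilde F(x_1;z_1)$. If $t\ge2$, draw $a$ uniformly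 from $[0,1]$ (fresh), set $x_t(a)=ax_t+(1-a)x_{t-1}$, sample $z_t\sim p(z;x_t(a))$, set $\tilde\Delta_t=\tilde\nabla^2F(x_t(a);z_t)(x_t-x_{t-1})$ and $d_t=(1-\rho_t)(d_{t-1}+\tilde\Delta_t)+\rho_t\nabla\tilde F(x_t;z_t)$. Then take $v_t\in\arg\max_{v\in\mathcal{K}}v^\top d_t$ and $x_{t+1}=x_t+\eta_tv_t$. The algorithm requires $x_1\in\mathcal{K}$. Expectations are over all the randomness of the algorithm. *)

(* Defs.v *)
From HB Require Import structures.
From mathcomp Require Export all_boot all_order all_algebra.
From mathcomp Require Export all_classical all_reals all_analysis.

Set Implicit Arguments.
Unset Strict Implicit.
Unset Printing Implicit Defensive.

Import Order.TTheory GRing.Theory Num.Theory.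
Import numFieldNormedType.Exports.

Local Open Scope classical_set_scope.
Local Open Scope ring_scope.

Section euclidean.
Context {R : realType}.

Definition inner d (u v : 'cV[R]_d) : R := (u^T *m v) 0 0.

(* The library norm on ['cV[R]_d] is the sup norm; it induces the same topology
   and the same notion of differentiability as this one. *)
Definition enorm d (u : 'cV[R]_d) : R := Num.sqrt (inner u u).

Definition spectral_norm m n (A : 'M[R]_(m, n)) : R :=
  sup [set enorm (A *m u) | u in [set u : 'cV[R]_n | enorm u <= 1]].

Definition lecv d (x y : 'cV[R]_d) : Prop := forall i, x i 0 <= y i 0.

Definition orthant {d} : set 'cV[R]_d := [set x | lecv 0 x].

Definition grad d (f : 'cV[R]_d -> R) (x : 'cV[R]_d) : 'cV[R]_d :=
  \col_i 'D_(delta_mx i 0) f x.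

Definition hess d (f : 'cV[R]_d -> R) (x : 'cV[R]_d) : 'M[R]_d :=
  \matrix_(i, j) 'D_(delta_mx j 0) (fun y => grad f y i 0) x.

Definition twice_differentiable d (f : 'cV[R]_d -> R) (x : 'cV[R]_d) : Prop :=
  (\forall y \near x, differentiable f y) /\ differentiable (grad f) x.

Definition is_radius d (K : set 'cV[R]_d) (rad : R) : Prop :=
  (exists2 x, K x & enorm x = rad) /\ (forall x, K x -> enorm x <= rad).

Definition is_argmax (T : Type) (K : set T) (f : T -> R) (x : T) : Prop :=
  K x /\ forall y, K y -> f y <= f x.

Definition monotone_orthant d (F : 'cV[R]_d -> R) : Prop :=
  forall x y, orthant x -> orthant y -> lecv x y -> F x <= F y.

Definition DR_submodular d (F : 'cV[R]_d -> R) : Prop :=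
  [/\ {within orthant, continuous F},
      (forall x, orthant x -> 0 <= F x),
      (forall x, orthant x -> differentiable F x) &
      (forall x y, orthant x -> orthant y -> lecv x y ->
        lecv (grad F y) (grad F x))].

End euclidean.

(* ['cV[R]_d] with its Borel sigma-algebra. *)
Notation borel_cV R d := (g_sigma_algebraType (@open 'cV[R]_d)).

Section model.
Context {R : realType} {d : nat} {dZ : measure_display} {Z : measurableType dZ}.
Variables (mu : {sigma_finite_measure set Z -> \bar R}).
Variables (p : 'cV[R]_d -> Z -> R) (Ft : 'cV[R]_d -> Z -> R).
Implicit Types (x : 'cV[R]_d) (z : Z) (K : set 'cV[R]_d).

Definition is_density x : Prop :=
  [/\ measurable_fun setT (p x), (forall z, 0 <= p x z) &
      (\int[mu]_z (p x z)%:E = 1)%E].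

Definition expect x (f : Z -> R) : R := (\int[mu]_z (f z * p x z))%R.

Definition mx_expect m n x (f : Z -> 'M[R]_(m, n)) : 'M[R]_(m, n) :=
  \matrix_(i, j) expect x (fun z => f z i j).

(* Unlike [expect], this is extended-real valued, so that a finite upper bound on
   the moment of a nonnegative function contains its finiteness. *)
Definition moment x (f : Z -> R) : \bar R := (\int[mu]_z (f z * p x z)%:E)%E.

Definition objective x : R := expect x (Ft x).

Definition log_density z x : R := ln (p x z).

Definition grad_Ft x z : 'cV[R]_d := grad (Ft ^~ z) x.
Definition hess_Ft x z : 'M[R]_d := hess (Ft ^~ z) x.
Definition score x z : 'cV[R]_d := grad (log_density z) x.
Definition hess_log x z : 'M[R]_d := hess (log_density z) x.

Definition hess_est x z : 'M[R]_d :=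
  Ft x z *: (score x z *m (score x z)^T) + hess_Ft x z
  + grad_Ft x z *m (score x z)^T + Ft x z *: hess_log x z
  + score x z *m (grad_Ft x z)^T.

Definition feasible K : set (borel_cV R d * Z) := [set xz | K xz.1].

(* log p(z; .) is differentiated at x only where p(z; x) > 0, which is a set of
   z of full p(.; x)-measure; [ln] is 0 on nonpositive reals. *)
Definition positive K : set (borel_cV R d * Z) :=
  [set xz | K xz.1 /\ 0 < p xz.1 xz.2].

Definition measurable_on m n (D : set (borel_cV R d * Z))
    (f : 'cV[R]_d -> Z -> 'M[R]_(m, n)) : Prop :=
  forall i j, measurable_fun D (fun xz : borel_cV R d * Z => f xz.1 xz.2 i j).

(* What is implicit in writing F(x) = E_{z ~ p(z; x)} [Ft(x; z)] for x in the
   positive orthant, in differentiating Ft and log p at the points of K, and in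
   taking expectations along a random trajectory in K. *)
Record well_posed K : Prop := WellPosed {
  wp_density : forall x, orthant x -> is_density x;
  wp_measurable_p : measurable_fun (feasible K)
    (fun xz : borel_cV R d * Z => p xz.1 xz.2);
  wp_measurable_Ft : measurable_fun (feasible K)
    (fun xz : borel_cV R d * Z => Ft xz.1 xz.2);
  wp_integrable : forall x, orthant x ->
    mu.-integrable setT (fun z => (Ft x z * p x z)%:E);
  wp_diff_Ft : forall x z, K x -> twice_differentiable (Ft ^~ z) x;
  wp_diff_log : forall x z, K x -> 0 < p x z ->
    twice_differentiable (log_density z) x;
  wp_measurable_grad : measurable_on (feasible K) grad_Ft;
  wp_measurable_hess : measurable_on (feasible K) hess_Ft;
  wp_measurable_score : measurable_on (positive K) score;
  wp_measurable_hess_log : measurable_on (positive K) hess_log }.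

End model.

Section algorithm.
Context {R : realType} {d : nat} {dZ : measure_display} {Z : measurableType dZ}.
Variables (mu : {sigma_finite_measure set Z -> \bar R}).
Variables (p : 'cV[R]_d -> Z -> R) (Ft : 'cV[R]_d -> Z -> R).
Context {dO : measure_display} {Om : measurableType dO} (P : probability Om R).
Variables (a : nat -> Om -> R) (z : nat -> Om -> Z).
Variables (x g v : nat -> Om -> 'cV[R]_d).

(* sigma-algebra of all the choices made in the iterations 1, ..., t - 1.  The
   v_s are listed because ties in the arg max may be broken at random. *)
Definition past (t : nat) : set (set Om) :=
  <<s \bigcup_(s in [set s | (1 <= s < t)%N])
        (preimage_set_system setT (z s) measurable `|`
         preimage_set_system setT (v s : Om -> borel_cV R d) measurable) `|`
      \bigcup_(s in [set s | (2 <= s < t)%N])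
        preimage_set_system setT (a s) measurable >>.

Definition past_and_a (t : nat) : set (set Om) :=
  <<s past t `|` preimage_set_system setT (a t) measurable >>.

Definition query (t : nat) (w : Om) : 'cV[R]_d :=
  a t w *: x t w + (1 - a t w) *: x t.-1 w.

(* [g t] is the gradient estimate d_t. *)
Record sfw_run (K : set 'cV[R]_d) (T : nat) (rho eta : nat -> R)
    (x1 : 'cV[R]_d) : Prop := SfwRun {
  run_measurable_z : forall t, (1 <= t <= T)%N -> measurable_fun setT (z t);
  run_measurable_a : forall t, (2 <= t <= T)%N -> measurable_fun setT (a t);
  run_measurable_v : forall t, (1 <= t <= T)%N ->
    measurable_fun setT (v t : Om -> borel_cV R d);
  run_x1 : forall w, x 1 w = x1;
  run_z1 : forall A, measurable A ->
    (P (z 1 @^-1` A) = \int[mu]_(y in A) (p x1 y)%:E)%E;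
  run_g1 : forall w, g 1 w = grad_Ft Ft (x 1 w) (z 1 w);
  run_a01 : forall t w, (2 <= t <= T)%N -> 0 <= a t w <= 1;
  (* a_t is uniform on [0, 1] and independent of the past *)
  run_a : forall t H B, (2 <= t <= T)%N -> past t H -> measurable B ->
    (P (H `&` a t @^-1` B) = P H * uniform_prob (@ltr01 R) B)%E;
  (* p(. ; x_t(a_t)) is the conditional law of z_t given the past and a_t *)
  run_z : forall t H A, (2 <= t <= T)%N -> past_and_a t H -> measurable A ->
    (P (H `&` z t @^-1` A) =
       \int[P]_(w in H) \int[mu]_(y in A) (p (query t w) y)%:E)%E;
  run_g : forall t w, (2 <= t <= T)%N ->
    g t w = (1 - rho t) *: (g t.-1 w +
                hess_est p Ft (query t w) (z t w) *m (x t w - x t.-1 w))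
            + rho t *: grad_Ft Ft (x t w) (z t w);
  run_v : forall t w, (1 <= t <= T)%N ->
    is_argmax K (fun u => inner u (g t w)) (v t w);
  run_x : forall t w, (1 <= t <= T)%N -> x t.+1 w = x t w + eta t *: v t w }.

End algorithm.

(* Main.v *)
From HB Require Import structures.
Require Import Defs.
From mathcomp Require Import ring lra measurable_realfun.

Set Implicit Arguments.
Unset Strict Implicit.
Unset Printing Implicit Defensive.

Import Order.TTheory GRing.Theory Num.Theory.
Import numFieldNormedType.Exports.

Local Open Scope classical_set_scope.
Local Open Scope ring_scope.

(** Why the theorem holds.

    Every iterate is [t / T] times an average of points of [K], hence lies in
    [K] ([iterate_in]), and so does every query point. A monotone DR-submodular
    function is concave along nonnegative directions, which yields
    [F xstar - F x <= inner (grad F x) xstar] ([DR_gap_le]). As [v] maximizes the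
    inner product with the estimate of [grad F x], one Frank-Wolfe step contracts
    the gap [F xstar - F x] by the factor [1 - T^-1], up to [2 * rad / T] times
    the error of the estimate and a second order term ([gap_step]). Iterating
    from [x = 0] gives the factor [expR (-1)] and leaves the sum of the errors to
    be estimated ([gap_le]).

    The heart is the bound [C / n.+1] on the mean square of the error of
    iteration [n.+1] ([mean_sqr_error_le]). The new error is, with weights
    [1 - rho] and [rho], a combination of the old error plus the noise of the
    Hessian estimator on one side, and of the noise of the stochastic gradient on
    the other ([next_error]). For a fixed past, the mean of the estimator over
    the sample and over the uniform query point is exactly the increment of the
    gradient: the mean over the sample is the Hessian of [F] at the query point,
    and its mean over the segment is given by the fundamental theorem of calculus
    ([integral_bounded_derivative]; the Hessian is bounded but need not be
    continuous). So this noise is orthogonal to the past, and its mean square is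
    at most the second moment of the estimator, [Lbar ^+ 2 * (rad / T) ^+ 2]
    ([has_mean_hess_est_sqr]). The stochastic gradient is evaluated at the
    iterate but sampled at the query point, so it is biased; both gradients are
    Lipschitz, and the bias is of order [rad * (L + Lbar) / T]. Altogether
    [mean_next_error_le] holds, and its right-hand side propagates [C / n.+1]
    by elementary algebra.

    The passage from a fixed past to the random trajectory is a disintegration
    ([integral_conditional_density]), applied to the sample given the past and
    the query parameter, then to the query parameter given the past. All
    integrands are kept nonnegative, so that no integrability has to be carried
    along the recursion. *)

(** * Euclidean vectors and the spectral norm *)

Section euclidean_space.
Context {R : realType} {d : nat}.
Implicit Types (u v w : 'cV[R]_d) (k : R).

Lemma innerE u v : inner u v = \sum_i u i 0 * v i 0.
Proof. by rewrite /inner mxE; apply: eq_bigr => i _; rewrite mxE. Qed.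

Lemma innerC u v : inner u v = inner v u.
Proof. by rewrite !innerE; apply: eq_bigr => i _; rewrite mulrC. Qed.

Lemma innerDl u v w : inner (u + v) w = inner u w + inner v w.
Proof.
by rewrite !innerE -big_split; apply: eq_bigr => i _; rewrite mxE mulrDl.
Qed.

Lemma innerDr u v w : inner w (u + v) = inner w u + inner w v.
Proof. by rewrite innerC innerDl !(innerC w). Qed.

Lemma innerZl k u v : inner (k *: u) v = k * inner u v.
Proof.
by rewrite !innerE mulr_sumr; apply: eq_bigr => i _; rewrite mxE mulrA.
Qed.

Lemma innerZr k u v : inner u (k *: v) = k * inner u v.
Proof. by rewrite innerC innerZl innerC. Qed.

Lemma innerNl u v : inner (- u) v = - inner u v.
Proof. by rewrite -scaleN1r innerZl mulN1r. Qed.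

Lemma innerNr u v : inner u (- v) = - inner u v.
Proof. by rewrite innerC innerNl innerC. Qed.

Definition inner_simpl := (innerDl, innerDr, innerZl, innerZr, innerNl, innerNr).

Lemma inner_ge0 u : 0 <= inner u u.
Proof. by rewrite innerE; apply: sumr_ge0 => i _; rewrite -expr2 sqr_ge0. Qed.

Lemma enorm_ge0 u : 0 <= enorm u.
Proof. exact: sqrtr_ge0. Qed.

Lemma enorm_sqr u : enorm u ^+ 2 = inner u u.
Proof. by rewrite sqr_sqrtr// inner_ge0. Qed.

Lemma inner_eq0 u v : inner u u = 0 -> inner u v = 0.
Proof.
rewrite innerE => /psumr_eq0P u0; rewrite innerE big1// => i _.
have {}u0 : u i 0 * u i 0 = 0 by apply: u0 => // j _; rewrite -expr2 sqr_ge0.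
by move/eqP: u0; rewrite mulf_eq0 orbb => /eqP ->; rewrite mul0r.
Qed.

Lemma inner_sqr_le u v : inner u v ^+ 2 <= inner u u * inner v v.
Proof.
have [v0|v0] := eqVneq (inner v v) 0.
  by rewrite innerC inner_eq0// v0 mulr0 expr0n.
have v0' : 0 < inner v v by rewrite lt_def v0 inner_ge0.
have := inner_ge0 (inner v v *: u - inner u v *: v).
rewrite !inner_simpl (innerC v u) => h.
rewrite -subr_ge0 -(pmulr_rge0 _ v0'); apply: le_trans h _.
by rewrite le_eqVlt; apply/orP; left; apply/eqP; ring.
Qed.

Lemma cauchy_schwarz_norm u v : `|inner u v| <= enorm u * enorm v.
Proof.
have h : 0 <= enorm u * enorm v by rewrite mulr_ge0 ?enorm_ge0.
rewrite -(ler_pXn2r (n := 2))// ?nnegrE//.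
by rewrite real_normK ?num_real// exprMn !enorm_sqr inner_sqr_le.
Qed.

Lemma cauchy_schwarz u v : inner u v <= enorm u * enorm v.
Proof. exact: le_trans (ler_norm _) (cauchy_schwarz_norm _ _). Qed.

Lemma enormN u : enorm (- u) = enorm u.
Proof. by rewrite /enorm innerNl innerNr opprK. Qed.

Lemma enormZ k u : enorm (k *: u) = `|k| * enorm u.
Proof.
by rewrite /enorm innerZl innerZr mulrA -expr2 sqrtrM ?sqr_ge0// sqrtr_sqr.
Qed.

Lemma ler_enormD u v : enorm (u + v) <= enorm u + enorm v.
Proof.
rewrite -(ler_pXn2r (n := 2))// ?nnegrE ?enorm_ge0 ?addr_ge0 ?enorm_ge0//.
rewrite enorm_sqr !inner_simpl -!enorm_sqr (innerC v u).
have := cauchy_schwarz u v; nra.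
Qed.

Lemma ler_enormB u v : enorm (u - v) <= enorm u + enorm v.
Proof. by rewrite -(enormN v) ler_enormD. Qed.

Lemma enorm0 : enorm (0 : 'cV[R]_d) = 0.
Proof. by rewrite -(scale0r 0) enormZ normr0 mul0r. Qed.

(** Bounds on mean vectors and on increments of vector functions are obtained by
    testing the vector against itself, which leaves a scalar mean or a scalar
    increment. *)
Lemma enorm_le_self u k : 0 <= k -> inner u u <= k * enorm u -> enorm u <= k.
Proof.
move=> k0; rewrite -enorm_sqr expr2.
have [->//|u0] := eqVneq (enorm u) 0.
by rewrite ler_pM2r// lt_def u0 enorm_ge0.
Qed.

Lemma inner_delta_mx u i : inner (delta_mx i 0) u = u i 0.
Proof.
rewrite innerE (bigD1 i)//= big1 ?addr0 ?mxE ?eqxx ?mul1r// => j ji.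
by rewrite mxE (negbTE ji) mul0r.
Qed.

Lemma ler_coord_enorm u i : `|u i 0| <= enorm u.
Proof.
rewrite -inner_delta_mx (le_trans (cauchy_schwarz_norm _ _))//.
by rewrite {1}/enorm inner_delta_mx mxE !eqxx sqrtr1 mul1r.
Qed.

End euclidean_space.

Lemma mulmx_inner_row (R : realType) m n (A : 'M[R]_(m, n)) (u : 'cV[R]_n) i :
  (A *m u) i 0 = inner (row i A)^T u.
Proof. by rewrite innerE mxE; apply: eq_bigr => j _; rewrite !mxE. Qed.

Lemma outer_mulmx (R : realType) m n (u : 'cV[R]_m) (v w : 'cV[R]_n) :
  u *m v^T *m w = inner v w *: u.
Proof.
by rewrite -mulmxA; apply/colP => i; rewrite !mxE big_ord1 mulrC /inner.
Qed.

Section spectral.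
Context {R : realType} {m n : nat}.
Implicit Types (A : 'M[R]_(m, n)) (u : 'cV[R]_n).

Let frobenius A : R := Num.sqrt (\sum_i inner (row i A)^T (row i A)^T).

Let enorm_mulmx_frobenius A u : enorm (A *m u) <= frobenius A * enorm u.
Proof.
rewrite /enorm /frobenius -sqrtrM; last first.
  by apply: sumr_ge0 => i _; exact: inner_ge0.
rewrite ler_wsqrtr// mulr_suml innerE; apply: ler_sum => i _.
by rewrite mulmx_inner_row -expr2 inner_sqr_le.
Qed.

(** The Frobenius norm shows that the supremum defining [spectral_norm] is
    finite. *)
Lemma spectral_has_sup A :
  has_sup [set enorm (A *m u) | u in [set u : 'cV[R]_n | enorm u <= 1]].
Proof.
split; first by exists (enorm (A *m 0)), 0 => //=; rewrite enorm0.
exists (frobenius A) => _ [u /= u1 <-].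
rewrite (le_trans (enorm_mulmx_frobenius _ _))//.
by rewrite -[leRHS]mulr1 ler_wpM2l// sqrtr_ge0.
Qed.

Lemma spectral_norm_ge0 A : 0 <= spectral_norm A.
Proof.
apply: le_trans (enorm_ge0 (A *m 0)) _; apply: ub_le_sup.
  by case: (spectral_has_sup A).
by exists 0 => //=; rewrite enorm0.
Qed.

Lemma enorm_mulmx A u : enorm (A *m u) <= spectral_norm A * enorm u.
Proof.
have [u0|u0] := eqVneq (enorm u) 0.
  by rewrite (le_trans (enorm_mulmx_frobenius _ _))// u0 !mulr0.
have u0' : 0 < enorm u by rewrite lt_def u0 enorm_ge0.
rewrite -ler_pdivrMr// mulrC; apply: ub_le_sup.
  by case: (spectral_has_sup A).
exists ((enorm u)^-1 *: u).
  by rewrite /= enormZ ger0_norm ?invr_ge0 ?enorm_ge0// mulVf.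
by rewrite -scalemxAr enormZ ger0_norm// invr_ge0 enorm_ge0.
Qed.

End spectral.

(** * Calculus along a segment *)

Section segment_calculus.
Context {R : realType} {d : nat}.
Implicit Types (f : 'cV[R]_d -> R) (x h c : 'cV[R]_d).

Lemma derive_grad f x h : differentiable f x -> 'D_h f x = inner (grad f x) h.
Proof.
move=> df; rewrite deriveE// {1}(matrix_sum_delta h) linear_sum innerE.
apply: eq_bigr => i _; rewrite big_ord1 linearZ /= -deriveE// mxE.
by rewrite mulrC.
Qed.

(** The difference quotients of [f] at [x + s *: h] along [h] are those of
    [t |-> f (x + t *: h)] at [s]. *)
Lemma is_derive_line f x h (s : R) : differentiable f (x + s *: h) ->
  is_derive s 1 (fun t => f (x + t *: h)) (inner (grad f (x + s *: h)) h).
Proof.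
move=> df; have Dq : (fun t : R => t^-1 *: (((fun t => f (x + t *: h)) \o shift s)
      (t *: 1) - f (x + s *: h))) =
    (fun t => t^-1 *: ((f \o shift (x + s *: h)) (t *: h) - f (x + s *: h))).
  apply/funext => t /=; congr (_ *: (f _ - _)).
  by rewrite [t *: _]mulr1 scalerDl addrCA.
have dl := @diff_derivable _ _ _ _ _ h df.
split; first by rewrite /derivable Dq.
by rewrite -derive_grad// /derive Dq.
Qed.

Lemma is_derive_grad_line f x h c (s : R) :
  twice_differentiable f (x + s *: h) ->
  is_derive s 1 (fun t => inner c (grad f (x + t *: h)))
    (inner c (hess f (x + s *: h) *m h)).
Proof.
move=> [_ df].
have dfi i : differentiable (fun y => grad f y i 0) (x + s *: h).
  exact: (differentiable_comp df (differentiable_coord _ i 0)).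
have -> : (fun t => inner c (grad f (x + t *: h))) =
    \sum_(i < d) (c i 0 *: (fun t : R => grad f (x + t *: h) i 0)).
  by apply/funext => t; rewrite innerE fct_sumE.
rewrite innerE; apply: is_derive_sum => i; apply: is_deriveZ => /=.
have -> : (hess f (x + s *: h) *m h) i 0 =
    inner (grad (fun y => grad f y i 0) (x + s *: h)) h.
  by rewrite innerE mxE; apply: eq_bigr => j _; rewrite !mxE.
exact: is_derive_line.
Qed.

End segment_calculus.

Section unit_interval.
Context {R : realType}.
Implicit Types (phi dphi : R -> R).

Lemma is_derive1_continuous phi (s l : R) :
  is_derive s 1 phi l -> {for s, continuous phi}.
Proof. by move=> dphi; apply/differentiable_continuous/derivable1_diffP. Qed.

Lemma MVT_sub phi dphi (s t : R) : s <= t ->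
  (forall u : R, s <= u <= t -> is_derive u 1 phi (dphi u)) ->
  exists2 c, s <= c <= t & phi t - phi s = dphi c * (t - s).
Proof.
move=> st dphiE.
have cphi : {within `[s, t], continuous phi}.
  apply: derivable_within_continuous => u; rewrite in_itv/= => ust.
  by case: (dphiE u ust).
have dphi' u : u \in `]s, t[ -> is_derive u 1 phi (dphi u).
  by rewrite in_itv/= => /andP[su ut]; apply: dphiE; rewrite !ltW.
have [c cst ->] := MVT_segment st dphi' cphi.
by exists c => //; move: cst; rewrite in_itv.
Qed.

Definition clamp (s : R) : R := Num.max 0 (Num.min s 1).

Lemma clamp_itv s : 0 <= clamp s <= 1.
Proof. by rewrite /clamp le_max lexx /= ge_max ler01 ge_min lexx orbT. Qed.

Lemma clamp_id s : 0 <= s <= 1 -> clamp s = s.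
Proof. by move=> /andP[s0 s1]; rewrite /clamp (min_idPl s1) (max_idPr s0). Qed.

Lemma continuous_clamp : continuous clamp.
Proof.
move=> s; apply: (@continuous_max R R (cst 0) (fun s => Num.min s 1)).
  exact: cvg_cst.
by apply: (@continuous_min R R id (cst 1)); [exact: cvg_id|exact: cvg_cst].
Qed.

(** Newton-Leibniz for a derivative that need not be continuous. The difference
    quotients of [phi], prolonged by constants, are bounded by [M] and tend to
    [dphi], so their integrals tend to that of [dphi]; and since the quotients
    are continuous, an antiderivative of [phi] computes those integrals, whose
    limit is [phi 1 - phi 0]. *)
Lemma integral_bounded_derivative phi dphi (M : R) :
  (forall s : R, 0 <= s <= 1 -> is_derive s 1 phi (dphi s)) ->
  (forall s : R, 0 <= s <= 1 -> `|dphi s| <= M) ->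
  lebesgue_measure.-integrable `[(0%R : R), 1%R] (EFin \o dphi) /\
  (\int[lebesgue_measure]_(s in `[(0%R : R), 1%R]) (dphi s)%:E
    = (phi 1 - phi 0)%:E)%E.
Proof.
move=> dphiE dphiM.
(* prolonging [phi] by constants makes the difference quotients at the points of
   the interval meaningful, and keeps them bounded by [M] *)
pose psi := phi \o clamp.
have psiE (s : R) : 0 <= s <= 1 -> psi s = phi s.
  by move=> s01; rewrite /psi/= clamp_id.
have cpsi : continuous psi.
  move=> s; apply: continuous_comp; first exact: continuous_clamp.
  exact: is_derive1_continuous (dphiE _ (clamp_itv s)).
pose Psi (x : R) : R := \int[lebesgue_measure]_(t in `[-1, x]) psi t.
have dPsi (x : R) : -1 < x -> is_derive x 1 Psi (psi x).
  move=> x1.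
  have int_psi : lebesgue_measure.-integrable `[-1, x + 1] (EFin \o psi).
    apply: continuous_compact_integrable; first exact: segment_compact.
    exact: continuous_subspaceT.
  have xx1 : x < x + 1 by rewrite ltrDl.
  have [dP PE] := continuous_FTC1_closed xx1 int_psi x1 (cpsi x).
  by split; [exact: dP|rewrite -derive1E; exact: PE].
pose e : R^nat := harmonic.
have e0 n : 0 < e n by exact: harmonic_gt0.
have e1 n : e n <= 1 by rewrite /e /harmonic invf_le1 ?ler1n ?ltr0n.
have e_cvg : e n @[n --> \oo] --> (0 : R) by exact: cvg_harmonic.
pose q n s : R := (e n)^-1 * (psi (s + e n) - psi s).
have cq n : continuous (q n).
  move=> s; apply: cvgM; first exact: cvg_cst.
  apply: cvgB; last exact: cpsi.
  apply: (@continuous_comp _ _ _ (fun s => s + e n) psi); last exact: cpsi.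
  by apply: cvgD; [exact: cvg_id|exact: cvg_cst].
pose G n s : R := (e n)^-1 * (Psi (s + e n) - Psi s).
have dG n (s : R) : -1 < s -> is_derive s 1 (G n) (q n s).
  move=> s1; have d1 := dPsi _ s1.
  have s1e : -1 < s + e n by rewrite (lt_trans s1)// ltrDl.
  have d2 := dPsi _ s1e.
  have d3 : is_derive s 1 (fun s => Psi (s + e n)) (psi (s + e n)).
    have := is_derive_shift s 1 (e n) => d3.
    have := @is_derive1_comp _ Psi (shift (e n)) s _ _ d2 d3.
    by rewrite mulr1.
  have -> : G n = (e n)^-1 *: ((fun s => Psi (s + e n)) - Psi) by [].
  exact: is_deriveZ.
have q_int n : (\int[lebesgue_measure]_(s in `[(0%R : R), 1%R]) (q n s)%:E
    = (G n 1 - G n 0)%:E)%E.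
  rewrite EFinB; apply: continuous_FTC2 => //.
  - exact: continuous_subspaceT.
  - split => [s||].
    + rewrite in_itv/= => /andP[s0 _].
      by have [] := dG n s (lt_trans (ltrN10 R) s0).
    + apply: cvg_at_right_filter.
      exact: is_derive1_continuous (dG n 0 (ltrN10 R)).
    + apply: cvg_at_left_filter.
      exact: is_derive1_continuous (dG n 1 (lt_trans (ltrN10 R) ltr01)).
  - move=> s; rewrite in_itv/= => /andP[s0 _]; rewrite derive1E.
    by have [] := dG n s (lt_trans (ltrN10 R) s0).
have cvg_quot (f : R -> R) (s l : R) : is_derive s 1 f l ->
    (e n)^-1 * (f (s + e n) - f s) @[n --> \oo] --> l.
  move=> [df dE].
  pose r := fun t : R => t^-1 *: ((f \o shift s) (t *: 1) - f s).
  have h : r t @[t --> 0^'] --> l by rewrite -dE; exact: df.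
  have -> : (fun n => (e n)^-1 * (f (s + e n) - f s)) = r \o e.
    by apply/funext => n /=; rewrite /r/= [_ *: 1]mulr1 (addrC s).
  by move/cvgr_dnbhsP: h; apply; split => // n; rewrite gt_eqF.
have cq_dphi s : 0 <= s < 1 -> q n s @[n --> \oo] --> dphi s.
  move=> /andP[s0 s1].
  have s01 : 0 <= s <= 1 by rewrite s0 ltW.
  apply: cvg_trans (cvg_quot _ _ _ (dphiE _ s01)).
  apply: near_eq_cvg; near=> n.
  have se1 : s + e n <= 1.
    rewrite addrC -lerBrDr ltW//; near: n.
    by apply: (cvgr_lt _ e_cvg); rewrite subr_gt0.
  by rewrite /q !psiE ?s0 ?(ltW s1)// se1 andbT addr_ge0// ltW.
have qM n s : 0 <= s < 1 -> `|q n s| <= M.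
  move=> /andP[s0 s1].
  have se : s <= clamp (s + e n).
    rewrite /clamp le_max le_min lerDl (ltW s1) andbT.
    by rewrite (ltW (e0 n)) orbT.
  have /andP[_ c1] := clamp_itv (s + e n).
  have dsub (u : R) : s <= u <= clamp (s + e n) -> is_derive u 1 phi (dphi u).
    by move=> /andP[su us]; apply: dphiE; rewrite (le_trans s0 su) (le_trans us).
  have [u /andP[su us] qE] := MVT_sub se dsub.
  have -> : q n s = (e n)^-1 * (phi (clamp (s + e n)) - phi s).
    by rewrite /q (psiE s) ?s0 ?(ltW s1).
  rewrite qE.
  rewrite mulrCA normrM -[leRHS]mulr1 ler_pM//.
    by apply: dphiM; rewrite (le_trans s0 su) (le_trans us).
  rewrite normrM gtr0_norm ?invr_gt0// mulrC ler_pdivrMr// mul1r.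
  rewrite ger0_norm ?subr_ge0// lerBlDl /clamp ge_max ge_min lexx /=.
  by rewrite addr_ge0// ltW.
have mdphi : measurable_fun `[(0%R : R), 1%R[ dphi.
  apply: (measurable_fun_cvg (h := q)) => [n|s].
    exact: measurable_funTS (continuous_measurable_fun (@cq n)).
  by rewrite /= in_itv/=; exact: cq_dphi.
have mM : lebesgue_measure.-integrable `[(0%R : R), 1%R[ (cst M%:E : R -> \bar R).
  apply/integrableP; split => //; rewrite integral_cst//=.
  by rewrite lebesgue_measure_itv/= lte_fin ltr01 -EFinB -EFinM ltry.
have mdphiE : measurable_fun `[(0%R : R), 1%R[ (EFin \o dphi) by exact/measurable_EFinP.
have int_dphi : lebesgue_measure.-integrable `[(0%R : R), 1%R] (EFin \o dphi).
  apply: (@le_integrable _ _ _ _ _ _ _ (cst M%:E)) => //.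
  - exact/measurable_EFinP/measurable_fun_itv_bndo_bndcP.
  - move=> s; rewrite /= in_itv/= => s01; rewrite lee_fin.
    by rewrite (le_trans (dphiM _ s01))// ler_norm.
  - apply/integrableP; split => //; rewrite integral_cst//=.
    by rewrite lebesgue_measure_itv/= lte_fin ltr01 -EFinB -EFinM ltry.
split => //.
have cvg_int : (\int[lebesgue_measure]_(s in `[(0%R : R), 1%R[) (q n s)%:E)%E
    @[n --> \oo] --> (\int[lebesgue_measure]_(s in `[(0%R : R), 1%R[) (dphi s)%:E)%E.
  have mD : measurable (`[(0%R : R), 1%R[%classic : set (measurableTypeR R)) by [].
  have := @dominated_cvg _ _ _ lebesgue_measure _ mD
    (fun n s => (q n s)%:E) (EFin \o dphi) (cst M%:E).
  apply => //.
  - move=> n; apply/measurable_EFinP.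
    exact: measurable_funTS (continuous_measurable_fun (@cq n)).
  - move=> s; rewrite /= in_itv/= => s01.
    by apply/cvg_EFin; [exact: nearW|exact: cq_dphi].
rewrite -integral_itv_bndo_bndc//; apply: cvg_unique cvg_int _ => //.
have -> : (fun n => (\int[lebesgue_measure]_(s in `[(0%R : R), 1%R[) (q n s)%:E)%E) =
    EFin \o (fun n => G n 1 - G n 0).
  apply/funext => n /=; rewrite integral_itv_bndo_bndc ?q_int//.
  apply/measurable_EFinP.
  exact: measurable_funTS (continuous_measurable_fun (@cq n)).
have -> : phi 1 - phi 0 = psi 1 - psi 0 by rewrite !psiE ?ler01 ?lexx.
apply: cvg_EFin; first exact: nearW.
by apply: cvgB; apply: cvg_quot; apply: dPsi; rewrite ?ltrN10// (lt_trans (ltrN10 R)).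
Unshelve. all: end_near.
Qed.

End unit_interval.
(** * Gradients on a convex set *)

Section convex_gradients.
Context {R : realType} {d : nat}.
Variables (K : set 'cV[R]_d) (f : 'cV[R]_d -> R) (L : R).
Hypothesis convK : convex_set K.
Hypothesis f2 : forall y, K y -> twice_differentiable f y.
Hypothesis L0 : 0 <= L.
Hypothesis hessL : forall y h, K y -> enorm (hess f y *m h) <= L * enorm h.

Lemma convex_set_segment x y (s : R) : K x -> K y -> 0 <= s <= 1 ->
  K (y + s *: (x - y)).
Proof.
move=> Kx Ky /andP[s0 s1].
have := convK (Itv01 s0 s1) (mem_set Kx) (mem_set Ky); rewrite inE.
congr K; rewrite /conv/= scalerBl scale1r scalerBr.
by rewrite addrC addrAC addrA.
Qed.

Lemma integral_hess_segment x y c : K x -> K y ->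
  lebesgue_measure.-integrable `[(0%R : R), 1%R]
    (fun s : R => (inner c (hess f (y + s *: (x - y)) *m (x - y)))%:E) /\
  (\int[lebesgue_measure]_(s in `[(0%R : R), 1%R])
    (inner c (hess f (y + s *: (x - y)) *m (x - y)))%:E
    = (inner c (grad f x - grad f y))%:E)%E.
Proof.
move=> Kx Ky.
have Ks (s : R) : 0 <= s <= 1 -> K (y + s *: (x - y)).
  exact: convex_set_segment.
have := @integral_bounded_derivative R
  (fun s => inner c (grad f (y + s *: (x - y))))
  (fun s => inner c (hess f (y + s *: (x - y)) *m (x - y)))
  (enorm c * (L * enorm (x - y))).
rewrite /= scale1r scale0r addr0 subrKC innerDr innerNr; apply.
  by move=> s s01; apply/is_derive_grad_line/f2/Ks.
move=> s s01; rewrite ler_norml.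
have ub u : enorm u <= L * enorm (x - y) ->
    inner c u <= enorm c * (L * enorm (x - y)).
  by move=> uL; rewrite (le_trans (cauchy_schwarz _ _))// ler_wpM2l ?enorm_ge0.
have hs := hessL (x - y) (Ks _ s01).
by rewrite lerNl -innerNr !ub// enormN.
Qed.

Lemma grad_lipschitz x y : K x -> K y ->
  enorm (grad f x - grad f y) <= L * enorm (x - y).
Proof.
move=> Kx Ky; apply: enorm_le_self; first by rewrite mulr_ge0 ?enorm_ge0.
set c := grad f x - grad f y.
have dc (s : R) : 0 <= s <= 1 -> is_derive s 1
    (fun s => inner c (grad f (y + s *: (x - y))))
    (inner c (hess f (y + s *: (x - y)) *m (x - y))).
  by move=> s01; exact/is_derive_grad_line/f2/convex_set_segment.
have [s s01] := MVT_sub ler01 dc.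
rewrite /= scale1r scale0r addr0 subrKC subr0 mulr1 => sE.
rewrite -/c {2}/c innerDr innerNr sE.
rewrite mulrC (le_trans (cauchy_schwarz _ _))// ler_wpM2l ?enorm_ge0//.
exact/hessL/convex_set_segment.
Qed.

(** Along the segment, [f] minus its tangent plus the quadratic
    [s ^+ 2 * (L / 2 * enorm h ^+ 2)] has a nonnegative derivative, because the
    gradient is [L]-Lipschitz. *)
Lemma smooth_lower_bound x h : K x -> K (x + h) ->
  f x + inner (grad f x) h - L / 2 * enorm h ^+ 2 <= f (x + h).
Proof.
move=> Kx Kxh.
have Ks (s : R) : 0 <= s <= 1 -> K (x + s *: h).
  by move=> s01; have := convex_set_segment Kxh Kx s01; rewrite addrAC subrr add0r.
pose psi (s : R) := f (x + s *: h) - s * inner (grad f x) h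
  + s ^+ 2 * (L / 2 * enorm h ^+ 2).
pose dpsi (s : R) := inner (grad f (x + s *: h)) h - inner (grad f x) h
  + 2 * s * (L / 2 * enorm h ^+ 2).
have dpsiE (s : R) : 0 <= s <= 1 -> is_derive s 1 psi (dpsi s).
  move=> s01; have d1 : is_derive s 1 (fun t => f (x + t *: h))
      (inner (grad f (x + s *: h)) h).
    by apply: is_derive_line; have [/nbhs_singleton] := f2 (Ks _ s01).
  apply: is_derive_eq; rewrite /dpsi /GRing.scale/=; ring.
have [s /[dup] s01 /andP[s0 s1]] := MVT_sub ler01 dpsiE.
rewrite subr0 mulr1 /psi scale1r scale0r addr0 => psiE.
suff : 0 <= dpsi s by rewrite -psiE; lra.
rewrite /dpsi.
have := cauchy_schwarz (grad f x - grad f (x + s *: h)) h.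
rewrite innerDl innerNl.
have := grad_lipschitz Kx (Ks _ s01).
rewrite opprD addNKr enormN enormZ ger0_norm// => lip.
have := ler_wpM2r (enorm_ge0 h) lip; nra.
Qed.

End convex_gradients.

(** * Monotone DR-submodular functions *)

Section dr_submodular.
Context {R : realType} {d : nat}.
Variable F : 'cV[R]_d -> R.
Hypothesis DRF : DR_submodular F.

Lemma orthantD (x u : 'cV[R]_d) : orthant x -> orthant u -> orthant (x + u).
Proof.
move=> x0 u0 i; have := x0 i; have := u0 i; rewrite !mxE => u0i x0i.
exact: addr_ge0.
Qed.

Lemma orthantZ (k : R) (u : 'cV[R]_d) : 0 <= k -> orthant u -> orthant (k *: u).
Proof. by move=> k0 u0 i; have := u0 i; rewrite !mxE => /(mulr_ge0 k0). Qed.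

Lemma inner_orthant_ge0 (u v : 'cV[R]_d) : orthant u -> orthant v ->
  0 <= inner u v.
Proof.
move=> u0 v0; rewrite innerE sumr_ge0// => i _; rewrite mulr_ge0//.
  by have := u0 i; rewrite mxE.
by have := v0 i; rewrite mxE.
Qed.

Lemma orthant_sub (u v : 'cV[R]_d) : lecv u v -> orthant (v - u).
Proof. by move=> uv i; rewrite !mxE subr_ge0. Qed.

Lemma lecv_addr (x u : 'cV[R]_d) : orthant u -> lecv x (x + u).
Proof. by move=> u0 i; have := u0 i; rewrite !mxE => ui; rewrite lerDl. Qed.

(** The derivative along a nonnegative direction decreases, since the points
    increase. *)
Lemma DR_concave (x u : 'cV[R]_d) : orthant x -> orthant u ->
  F (x + u) - F x <= inner (grad F x) u.
Proof.
have [_ _ dF gF] := DRF; move=> x0 u0.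
have os (s : R) : 0 <= s -> orthant (x + s *: u).
  by move=> s0; apply: orthantD => //; exact: orthantZ.
have [|s /andP[s0 _]] := @MVT_sub R (fun s => F (x + s *: u))
    (fun s => inner (grad F (x + s *: u)) u) _ _ ler01.
  by move=> s /andP[s0 _]; apply/is_derive_line/dF/os.
rewrite /= scale1r scale0r addr0 subr0 mulr1 => ->.
rewrite -subr_ge0 -innerNl -innerDl inner_orthant_ge0//.
apply: orthant_sub; apply: (gF x (x + s *: u) x0 (os _ s0)); exact/lecv_addr/orthantZ.
Qed.

Hypothesis monF : monotone_orthant F.

Lemma grad_monotone_ge0 (x : 'cV[R]_d) : orthant x -> orthant (grad F x).
Proof.
move=> x0 i; have [_ _ dF _] := DRF.
have e0 : orthant (delta_mx i 0 : 'cV[R]_d).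
  by move=> j; rewrite !mxE ler0n.
rewrite [leLHS]mxE -(inner_delta_mx (grad F x)) innerC.
apply: le_trans (DR_concave x0 e0).
by rewrite subr_ge0; apply: monF => //; [exact: orthantD|exact: lecv_addr].
Qed.

(** Moving from [x] to the coordinatewise maximum of [x] and [y] is a nonnegative
    step that [y] dominates. *)
Lemma DR_gap_le (x y : 'cV[R]_d) : orthant x -> orthant y ->
  F y - F x <= inner (grad F x) y.
Proof.
move=> x0 y0; pose u : 'cV[R]_d := \col_i Num.max 0 (y i 0 - x i 0).
have u0 : orthant u by move=> i; rewrite !mxE le_max lexx.
have yxu : lecv y (x + u).
  by move=> i; rewrite !mxE -lerBlDl le_max lexx orbT.
have uy : lecv u y.
  move=> i; rewrite !mxE ge_max; have := y0 i; have := x0 i.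
  by rewrite !mxE => xi yi; rewrite yi gerBl.
apply: (@le_trans _ _ (F (x + u) - F x)).
  by rewrite lerB// monF//; exact: orthantD.
apply: le_trans (DR_concave x0 u0) _.
rewrite -subr_ge0 -innerNr -innerDr inner_orthant_ge0//.
  exact: grad_monotone_ge0.
exact: orthant_sub.
Qed.

End dr_submodular.

(** * Two numerical estimates *)

Lemma sum_inv_sqrt_le (R : realType) (n : nat) :
  \sum_(i < n) (Num.sqrt i.+1%:R : R)^-1 <= 2 * Num.sqrt n%:R.
Proof.
elim: n => [|n ih]; first by rewrite big_ord0 mulr_ge0 ?sqrtr_ge0.
rewrite big_ord_recr/=; apply: le_trans (lerD ih (lexx _)) _.
have a2 : Num.sqrt n%:R ^+ 2 = n%:R :> R by rewrite sqr_sqrtr ?ler0n.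
have b2 : Num.sqrt n.+1%:R ^+ 2 = n%:R + 1 :> R.
  by rewrite sqr_sqrtr ?ler0n// natr1.
have b0 : 0 < Num.sqrt n.+1%:R :> R by rewrite sqrtr_gt0 ltr0n.
move: (Num.sqrt n%:R) (Num.sqrt n.+1%:R) a2 b2 b0 => s t s2 t2 t0.
rewrite -(ler_pM2r t0) mulrDl mulVf ?gt_eqF//.
have := sqr_ge0 (t - s); lra.
Qed.

Lemma onem_inv_exp_le (R : realType) (n : nat) : (0 < n)%N ->
  (1 - n%:R^-1) ^+ n <= expR (-1) :> R.
Proof.
move=> n0; have np : (0 : R) < n%:R by rewrite ltr0n.
have -> : expR (-1) = expR (- n%:R^-1) ^+ n :> R.
  by rewrite -expRM_natl mulrN mulfV ?gt_eqF.
apply: lerXn2r; rewrite ?nnegrE ?expR_ge0//.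
  by rewrite subr_ge0 invf_le1// ler1n.
exact: expR_ge1Dx.
Qed.

(** * Conditional laws given a sub-sigma-algebra *)

Section density.
Context d (T : measurableType d) (R : realType).
Variables (nu : {finite_measure set T -> \bar R})
          (mu : {sigma_finite_measure set T -> \bar R}).
Variable k : T -> R.
Hypothesis mk : measurable_fun setT k.

Hypothesis nuE : forall E, measurable E ->
  nu E = (\int[mu]_(t in E) (k t)%:E)%E.

(** [k] agrees almost everywhere with the Radon-Nikodym derivative of [nu]. *)
Lemma ge0_integral_density (f : T -> \bar R) : measurable_fun setT f ->
  (forall t, (0 <= f t)%E) ->
  (\int[nu]_t f t = \int[mu]_t (f t * (k t)%:E))%E.
Proof.
move=> mf f0.
have mkE : measurable_fun setT (EFin \o k) by exact/measurable_EFinP.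
have nu_mu : nu `<< mu.
  apply/null_content_dominatesP => A mA muA0; rewrite nuE//.
  apply: null_set_integral => //; exact: measurable_funTS.
rewrite -(Radon_Nikodym_SigmaFinite.change_of_variables nu_mu f0)//.
have mh : measurable_fun setT (Radon_Nikodym_SigmaFinite.f nu mu).
  exact: measurable_int (Radon_Nikodym_SigmaFinite.f_integrable nu_mu).
apply: ae_eq_integral => //; [exact: emeasurable_funM|exact: emeasurable_funM|].
have : ae_eq mu setT (Radon_Nikodym_SigmaFinite.f nu mu) (EFin \o k).
  apply: integral_ae_eq => //.
    exact: Radon_Nikodym_SigmaFinite.f_integrable.
  move=> A _ mA.
  by rewrite -(Radon_Nikodym_SigmaFinite.f_integral nu_mu)// nuE.
by apply: filterS => t h /h ->.
Qed.

End density.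

Section sub_sigma_algebra.
Context dO (Om : measurableType dO).

Lemma measurable_fun_sub_ambient d (T : measurableType d) (G : set (set Om))
    (f : Om -> T) : <<s G >> `<=` measurable ->
  measurable_fun setT (f : g_sigma_algebraType G -> T) ->
  measurable_fun setT f.
Proof. by move=> GO mf _ A mA; apply: GO; exact: mf. Qed.

Lemma measurable_fun_generating d (T : measurableType d) (G : set (set Om))
    (f : Om -> T) : preimage_set_system setT f measurable `<=` G ->
  measurable_fun setT (f : g_sigma_algebraType G -> T).
Proof.
by move=> fG _ A mA; apply: sub_sigma_algebra; apply: fG; exists A.
Qed.

Context dZ (Z : measurableType dZ) (R : realType).
Variables (P : probability Om R) (mu : {sigma_finite_measure set Z -> \bar R}).
Variable G : set (set Om).
Hypothesis GO : <<s G >> `<=` measurable.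
Local Notation OmG := (g_sigma_algebraType G).
Variables (zeta : Om -> Z) (k : OmG * Z -> R).
Hypothesis mzeta : measurable_fun setT zeta.
Hypothesis mk : measurable_fun setT k.
Hypothesis k0 : forall e, 0 <= k e.
Hypothesis lawE : forall (H : set Om) A, <<s G >> H -> measurable A ->
  P (H `&` zeta @^-1` A) =
    (\int[P]_(w in H) \int[mu]_(y in A) (k (w, y))%:E)%E.

(** The tower rule, when the conditional law of [zeta] given [G] has the density
    [k]. The law of [w |-> (w, zeta w)] on [OmG * Z] and the measure of density
    [k] agree on rectangles, hence everywhere. *)
Theorem integral_conditional_density (f : OmG * Z -> \bar R) :
  measurable_fun setT f -> (forall e, (0 <= f e)%E) ->
  (\int[P]_w f (w, zeta w) = \int[P]_w \int[mu]_y (f (w, y) * (k (w, y))%:E))%E.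
Proof.
move=> mf f0.
have mid : measurable_fun setT (id : Om -> OmG).
  by move=> _ A mA; rewrite setTI; exact: GO.
pose idG : {mfun Om >-> OmG} :=
  HB.pack (id : Om -> OmG) (isMeasurableFun.Build _ _ _ _ _ mid).
have mpair : measurable_fun setT (fun w => (w, zeta w) : OmG * Z).
  exact: measurable_fun_pair.
pose pair : {mfun Om >-> (OmG * Z)%type} :=
  HB.pack (fun w : Om => (w, zeta w) : OmG * Z)
    (isMeasurableFun.Build _ _ _ _ _ mpair).
pose PG : probability OmG R := distribution P idG.
pose nu := distribution P pair.
have mkE : measurable_fun setT (EFin \o k) by exact/measurable_EFinP.
have k0E e : (0 <= (k e)%:E)%E by rewrite lee_fin.
pose m2 := (fun E => \int[PG \x mu]_(e in E) (k e)%:E)%E.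
have m20 : m2 set0 = 0%E by rewrite /m2 integral_set0.
have m2_ge0 E : (0 <= m2 E)%E by exact: integral_ge0.
have m2_add : semi_sigma_additive m2 by exact: semi_sigma_additive_nng_induced.
pose m2' : {measure set (OmG * Z) -> \bar R} :=
  HB.pack m2 (isMeasure.Build _ _ _ m2 m20 m2_ge0 m2_add).
have nuE (E : set (OmG * Z)) : measurable E -> nu E = m2 E.
  move=> mE.
  apply: (measure_unique
    [set A `*` B | A in @measurable _ OmG & B in @measurable _ Z]
    (fun=> setT) _ _ _ _ nu m2') => //.
  - exact: measurable_prod_measurableType.
  - move=> _ _ [A1 mA1 [B1 mB1 <-]] [A2 mA2 [B2 mB2 <-]].
    exists (A1 `&` A2); first exact: measurableI.
    by exists (B1 `&` B2); [exact: measurableI|rewrite setXI].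
  - by move=> _; exists setT => //; exists setT => //; rewrite setXTT.
  - by rewrite bigcup_const.
  - move=> _ [H mH [A mA <-]].
    transitivity (P (H `&` zeta @^-1` A)); first by [].
    have mHA : measurable (H `*` A : set (OmG * Z)) by exact: measurableX.
    have mkHA : measurable_fun setT ((EFin \o k) \_ (H `*` A)).
      by apply/(measurable_restrictT _ mHA); exact: measurable_funTS.
    have kHA0 e : (0 <= ((EFin \o k) \_ (H `*` A)) e)%E.
      by rewrite patchE; case: ifP => // _; exact: k0E.
    have -> : m2' (H `*` A) =
        (\int[PG \x mu]_e ((EFin \o k) \_ (H `*` A)) e)%E.
      by rewrite -integral_mkcond.
    rewrite (lawE mH mA) integral_mkcond.
    rewrite fubini_tonelli1// /PG ge0_integral_distribution//; first last.
    + by move=> w; exact: integral_ge0.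
    + exact: measurable_fun_fubini_tonelli_F.
    apply: eq_integral => w _; rewrite patchE /= /fubini_F.
    case: ifPn => wH.
      rewrite [LHS]integral_mkcond; apply: eq_integral => y _.
      by rewrite !patchE in_setX wH.
    rewrite integral0_eq// => y _; rewrite patchE in_setX.
    by rewrite (negbTE wH).
  - by move=> _; exact: le_lt_trans (probability_le1 nu measurableT) (ltry _).
rewrite -(@ge0_integral_distribution _ _ _ _ _ P pair f)//.
have m12_sf : sigma_finite setT (PG \x mu)%E.
  have /sigma_finiteP[F [TF _ Foo]] := sigma_finiteT mu.
  exists (fun n => setT `*` F n) => [|n].
    by rewrite -setX_bigcupr -TF setXTT.
  have [mF Fn] := Foo n; split; first exact: measurableX.
  by rewrite product_measure1E// lte_mul_pinfty//; exact: fin_num_measure.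
pose m12 : {sigma_finite_measure set (OmG * Z)%type -> \bar R} :=
  HB.pack (PG \x mu)%E (Measure_isSigmaFinite.Build _ _ _ (PG \x mu)%E m12_sf).
rewrite (@ge0_integral_density _ _ R nu m12 k mk nuE f mf f0) /m12/=.
rewrite fubini_tonelli1//; first last.
- by move=> e; rewrite mule_ge0.
- exact: emeasurable_funM.
rewrite /PG ge0_integral_distribution//; first last.
- by move=> w; apply: integral_ge0 => y _; rewrite mule_ge0.
- apply: measurable_fun_fubini_tonelli_F => //.
    exact: emeasurable_funM.
  by move=> e; rewrite mule_ge0.
Qed.

End sub_sigma_algebra.
(** * Borel sets of Euclidean space *)

Section borel_space.
Context {R : realType} {d : nat}.

Lemma measurable_borel_open (U : set 'cV[R]_d) : open U ->
  measurable (U : set (borel_cV R d)).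
Proof. exact: sub_sigma_algebra. Qed.

Lemma measurable_borel_closed (U : set 'cV[R]_d) : closed U ->
  measurable (U : set (borel_cV R d)).
Proof.
move=> cU; rewrite -[U]setCK; apply: measurableC.
by apply: measurable_borel_open; exact: closed_openC.
Qed.

(** On [D], the preimage of an open set coincides with its interior. *)
Lemma measurable_fun_continuous_on (D : set 'cV[R]_d) (f : 'cV[R]_d -> R) :
  (forall x, D x -> {for x, continuous f}) ->
  measurable_fun (D : set (borel_cV R d)) (f : borel_cV R d -> R).
Proof.
move=> cf mD; apply: (measurability _ (RGenOpens.measurableE R)) => //.
move=> _ [_ [a [b ->]] <-].
have -> : D `&` f @^-1` `]a, b[ = D `&` (f @^-1` `]a, b[)^°.
  apply/seteqP; split => x [Dx fx]; split => //; last exact: interior_subset.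
  by apply: (cf x Dx); apply: open_nbhs_nbhs; split => //; exact: itv_open.
apply: measurableI => //; apply: measurable_borel_open; exact: open_interior.
Qed.

Lemma measurable_coord (i : 'I_d) :
  measurable_fun setT (fun v : borel_cV R d => v i 0).
Proof.
by apply: measurable_fun_continuous_on => x _; exact: coord_continuous.
Qed.

(** Every open set is a countable union of balls with rational centres and
    radii, and the preimage of a ball is cut out by the coordinates. *)
Lemma measurable_fun_borel dT (T : measurableType dT) (f : T -> 'cV[R]_d) :
  (forall i, measurable_fun setT (fun t => f t i 0)) ->
  measurable_fun setT (f : T -> borel_cV R d).
Proof.
move=> mf; apply: (@measurability _ _ _ (borel_cV R d) _ _ (@open 'cV[R]_d)) => //.
move=> _ [U oU <-]; rewrite setTI.
pose c (q : 'cV[rat]_d) : 'cV[R]_d := map_mx ratr q.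
pose F (q : 'cV[rat]_d * nat) : set T :=
  if `[< ball (c q.1) q.2.+1%:R^-1 `<=` U >]
  then [set t | forall i, `|f t i 0 - c q.1 i 0| < q.2.+1%:R^-1] else set0.
have -> : f @^-1` U = \bigcup_q F q.
  apply/seteqP; split => [t Ut|t [[q n] _]]; last first.
    rewrite /F/=; case: asboolP => // qU tq; apply: qU.
    split=> [|i j]; first by rewrite invr_gt0.
    by rewrite (ord1 j) /ball/= distrC; exact: tq.
  have /nbhs_ballP[e /= e0 eU] : nbhs (f t) U by exact: open_nbhs_nbhs.
  have [n ne] : exists n : nat, n.+1%:R^-1 < e / 2.
    have e20 : 0 < e / 2 by rewrite divr_gt0.
    have [n _ /(_ n (leqnn n)) ne] := cvgr_lt _ (@cvg_harmonic R) _ e20.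
    by exists n.
  have n0 : (0 : R) < n.+1%:R^-1 by rewrite invr_gt0.
  have /choice[q qE] : forall i : 'I_d, exists q : rat,
      `|f t i 0 - ratr q| < n.+1%:R^-1.
    move=> i; have : f t i 0 - n.+1%:R^-1 < f t i 0 + n.+1%:R^-1.
      by rewrite ltrBlDr -addrA ltrDl addr_gt0.
    move=> /rat_in_itvoo[q]; rewrite in_itv/= -ltr_distlC => qn.
    by exists q.
  exists (\col_i q i, n) => //; rewrite /F/=.
  have tq i : `|f t i 0 - c (\col_i q i) i 0| < n.+1%:R^-1 by rewrite !mxE.
  case: asboolP => // -[] u [_ uq]; apply: eU; split => // i j.
  rewrite (ord1 j) /ball/= -(subrKA (c (\col_i q i) i 0)).
  rewrite (le_lt_trans (ler_normD _ _))// (splitr e) ltrD//.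
    exact: lt_trans (tq i) ne.
  exact: lt_trans (uq i 0) ne.
apply: countable_bigcupT_measurable => // -[q n]; rewrite /F/=.
case: asboolP => // _.
have -> : [set t | forall i, `|f t i 0 - c q i 0| < n.+1%:R^-1] =
    \bigcap_(i in [set: 'I_d])
      ((fun t => `|f t i 0 - c q i 0|) @^-1` `]-oo, n.+1%:R^-1[).
  apply/seteqP; split => [t + i _|t + i]; first by rewrite /= in_itv/=; exact.
  by move=> /(_ i I); rewrite /= in_itv.
apply: fin_bigcap_measurable => [//|i _]; rewrite -[X in measurable X]setTI.
have mi : measurable_fun setT (fun t => `|f t i 0 - c q i 0|).
  apply: measurableT_comp => //; exact: measurable_funB.
by apply: mi => //; exact: measurable_itv.
Qed.

End borel_space.
(** * Moments under the densities *)

(** Comparison for functions that may fail to be measurable, such as the spectral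
    norm of a random matrix: the integral of a nonnegative function is a supremum
    over the simple functions below it. *)
Lemma ge0_le_integral_any d (T : measurableType d) (R : realType)
    (mu : {measure set T -> \bar R}) (f g : T -> \bar R) :
  (forall t, (0 <= f t)%E) -> (forall t, (f t <= g t)%E) ->
  (\int[mu]_t f t <= \int[mu]_t g t)%E.
Proof.
move=> f0 fg; have g0 t : (0 <= g t)%E by exact: le_trans (fg t).
rewrite !ge0_integralTE//; apply: le_ereal_sup => _ [h hf <-].
by exists h => // t; exact: le_trans (fg t).
Qed.

Lemma ge0_le_integral_any_in d (T : measurableType d) (R : realType)
    (mu : {measure set T -> \bar R}) (E : set T) (f g : T -> \bar R) :
  (forall t, E t -> (0 <= f t)%E) -> (forall t, E t -> (f t <= g t)%E) ->
  (\int[mu]_(t in E) f t <= \int[mu]_(t in E) g t)%E.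
Proof.
move=> f0 fg; rewrite 2!(integral_mkcond E).
apply: ge0_le_integral_any => t; rewrite ?patchE.
  by case: ifPn => // /set_mem /f0.
by case: ifPn => // /set_mem /fg.
Qed.

Lemma integral_probability_cst d (T : measurableType d) (R : realType)
    (P : probability T R) (k : R) : (\int[P]_w k%:E = k%:E)%E.
Proof.
apply: etrans (integral_cst P measurableT k%:E) _.
by rewrite -[RHS]mule1; congr (_ * _)%E; exact: probability_setT.
Qed.

Section means.
Context {R : realType} {d : nat} {dZ : measure_display} {Z : measurableType dZ}.
Variables (mu : {sigma_finite_measure set Z -> \bar R}).
Variables (p : 'cV[R]_d -> Z -> R) (q : 'cV[R]_d).
Hypothesis pq : is_density mu p q.
Implicit Types (f g : Z -> R) (r s k : R).

(** Unlike [expect], which is total, [has_mean] contains integrability. *)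
Definition has_mean f r : Prop :=
  mu.-integrable setT (fun z => (f z * p q z)%:E) /\
  (\int[mu]_z (f z * p q z)%:E = r%:E)%E.

Lemma has_mean_expect f r : has_mean f r -> expect mu p q f = r.
Proof. by case=> _ fr; rewrite /expect /Rintegral fr. Qed.

Lemma has_mean_ext f g r : (forall z, f z * p q z = g z * p q z) ->
  has_mean f r -> has_mean g r.
Proof.
move=> fg; rewrite /has_mean.
by have -> : (fun z => (f z * p q z)%:E) = (fun z => (g z * p q z)%:E)
  by apply/funext => z; rewrite fg.
Qed.

Lemma has_mean_cst k : has_mean (fun=> k) k.
Proof.
have [mp p0 p1] := pq.
have ip : mu.-integrable setT (fun z => (p q z)%:E).
  apply/integrableP; split; first exact/measurable_EFinP.
  under eq_integral do rewrite gee0_abs ?lee_fin//.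
  by rewrite p1 ltry.
split; first exact: (integrableZl measurableT k ip).
have /= := integralZl measurableT ip k.
by under eq_integral do rewrite -EFinM; rewrite p1 mule1.
Qed.

Lemma has_meanD f g r s : has_mean f r -> has_mean g s ->
  has_mean (fun z => f z + g z) (r + s).
Proof.
move=> [intf fr] [intg gs].
have E : (fun z => ((f z + g z) * p q z)%:E) =
    ((fun z => (f z * p q z)%:E) \+ (fun z => (g z * p q z)%:E))%E.
  by apply/funext => z; rewrite mulrDl EFinD.
split; first by rewrite E; exact: integrableD.
by rewrite E integralD// fr gs.
Qed.

Lemma has_meanZ k f r : has_mean f r -> has_mean (fun z => k * f z) (k * r).
Proof.
move=> [intf fr].
have E : (fun z => (k * f z * p q z)%:E) = (fun z => k%:E * (f z * p q z)%:E)%E.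
  by apply/funext => z; rewrite -mulrA EFinM.
split; first by rewrite E; exact: (integrableZl measurableT k intf).
by rewrite E integralZl// fr.
Qed.

Lemma has_mean_sum (I : Type) (s : seq I) (f : I -> Z -> R) (r : I -> R) :
  (forall i, has_mean (f i) (r i)) ->
  has_mean (fun z => \sum_(i <- s) f i z) (\sum_(i <- s) r i).
Proof.
move=> fr; elim: s => [|i s ih].
  rewrite big_nil; apply: has_mean_ext (has_mean_cst 0) => z.
  by rewrite big_nil.
rewrite big_cons; apply: has_mean_ext (has_meanD (fr i) ih) => z.
by rewrite big_cons.
Qed.

Lemma has_mean_le f g r s : (forall z, f z * p q z <= g z * p q z) ->
  has_mean f r -> has_mean g s -> r <= s.
Proof.
move=> fg [intf fr] [intg gs]; rewrite -lee_fin -fr -gs.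
by apply: le_integral => // z _; rewrite lee_fin.
Qed.

Lemma has_mean_ge0 f M : measurable_fun setT (fun z => f z * p q z) ->
  (forall z, 0 <= f z) -> (\int[mu]_z (f z * p q z)%:E <= M%:E)%E ->
  exists2 r, has_mean f r & r <= M.
Proof.
move=> mf f0 fM; have [_ p0 _] := pq.
have i0 : (0 <= \int[mu]_z (f z * p q z)%:E)%E.
  by apply: integral_ge0 => z _; rewrite lee_fin mulr_ge0.
have ifin : (\int[mu]_z (f z * p q z)%:E \is a fin_num)%E.
  by rewrite ge0_fin_numE// (le_lt_trans fM)// ltry.
exists (fine (\int[mu]_z (f z * p q z)%:E)); last first.
  by rewrite -lee_fin fineK.
split; last by rewrite fineK.
apply/integrableP; split; first exact/measurable_EFinP.
under eq_integral do rewrite gee0_abs ?lee_fin ?mulr_ge0//.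
by rewrite (le_lt_trans fM)// ltry.
Qed.

Lemma has_mean_bounded f g s : measurable_fun setT (fun z => f z * p q z) ->
  (forall z, `|f z| <= g z) -> has_mean g s -> exists r, has_mean f r.
Proof.
move=> mf fg [intg _]; have [_ p0 _] := pq.
have intf : mu.-integrable setT (fun z => (f z * p q z)%:E).
  apply: le_integrable intg => //; first exact/measurable_EFinP.
  move=> z _; rewrite lee_fin !normrM ler_wpM2r//.
  by rewrite (le_trans (fg z))// ler_norm.
exists (fine (\int[mu]_z (f z * p q z)%:E)); split => //.
by rewrite fineK// integrable_fin_num.
Qed.

End means.

(** * The Hessian estimator *)

Section measurable_vectors.
Context {R : realType} {d : nat} {dT} {T : measurableType dT}.
Variable D : set T.

Definition measurable_vec (f : T -> 'cV[R]_d) : Prop :=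
  forall i, measurable_fun D (fun t => f t i 0).

Lemma measurable_vecD (f g : T -> 'cV[R]_d) :
  measurable_vec f -> measurable_vec g -> measurable_vec (fun t => f t + g t).
Proof.
move=> mf mg i; under eq_fun do rewrite mxE.
exact: measurable_funD.
Qed.

Lemma measurable_vecZ (k : T -> R) (f : T -> 'cV[R]_d) :
  measurable_fun D k -> measurable_vec f -> measurable_vec (fun t => k t *: f t).
Proof.
move=> mk mf i; under eq_fun do rewrite mxE.
exact: measurable_funM.
Qed.

Lemma measurable_vec_cst (u : 'cV[R]_d) : measurable_vec (fun=> u).
Proof. by move=> i; exact: measurable_cst. Qed.

Lemma measurable_vecB (f g : T -> 'cV[R]_d) :
  measurable_vec f -> measurable_vec g -> measurable_vec (fun t => f t - g t).
Proof.
move=> mf mg i; under eq_fun do rewrite 2!mxE.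
exact: measurable_funB.
Qed.

Lemma measurable_vec_mulmx (A : T -> 'M[R]_d) (f : T -> 'cV[R]_d) :
  (forall i j, measurable_fun D (fun t => A t i j)) ->
  measurable_vec f -> measurable_vec (fun t => A t *m f t).
Proof.
move=> mA mf i; under eq_fun do rewrite mxE.
by apply: measurable_sum => j; exact: measurable_funM.
Qed.

Lemma measurable_inner (f g : T -> 'cV[R]_d) :
  measurable_vec f -> measurable_vec g ->
  measurable_fun D (fun t => inner (f t) (g t)).
Proof.
move=> mf mg; under eq_fun do rewrite innerE.
by apply: measurable_sum => j; exact: measurable_funM.
Qed.

End measurable_vectors.

Section sfw.
Context {R : realType} {d : nat} {dZ : measure_display} {Z : measurableType dZ}.
Variables (mu : {sigma_finite_measure set Z -> \bar R}).
Variables (p Ft : 'cV[R]_d -> Z -> R) (K : set 'cV[R]_d).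
Hypothesis KO : K `<=` orthant.
Hypothesis mK : measurable (K : set (borel_cV R d)).
Hypothesis wp : well_posed mu p Ft K.
Implicit Types (q h c : 'cV[R]_d).

(** The score and the Hessian of the logarithm are only meaningful, and only
    measurable, where the density is positive. Setting them to zero elsewhere
    changes no expectation and alters the algorithm on a null event. *)
Definition mask m n (f : 'cV[R]_d -> Z -> 'M[R]_(m, n)) q z : 'M[R]_(m, n) :=
  if 0 < p q z then f q z else 0.

Lemma density_ge0 q z : K q -> 0 <= p q z.
Proof. by move=> /KO /(wp_density wp)[]. Qed.

Lemma maskM (m n : nat) (f : 'cV[R]_d -> Z -> 'M[R]_(m, n)) q z
    (phi : 'M[R]_(m, n) -> R) : K q ->
  phi (mask f q z) * p q z = phi (f q z) * p q z.
Proof.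
move=> Kq; rewrite /mask; case: ltP => // p0.
have -> : p q z = 0 by apply/eqP; rewrite eq_le p0 density_ge0.
by rewrite !mulr0.
Qed.

Lemma measurable_feasible : measurable (feasible K : set (borel_cV R d * Z)).
Proof.
have -> : feasible K = (K : set (borel_cV R d)) `*` [set: Z].
  by apply/seteqP; split => [x|x []]//.
exact: measurableX.
Qed.

Lemma measurable_mask (m n : nat) (f : 'cV[R]_d -> Z -> 'M[R]_(m, n)) :
  measurable_on (positive p K) f -> measurable_on (feasible K) (mask f).
Proof.
move=> mf i j.
have -> : (fun xz : borel_cV R d * Z => mask f xz.1 xz.2 i j) =
    (fun xz => if 0 < p xz.1 xz.2 then f xz.1 xz.2 i j else 0).
  by apply/funext => xz; rewrite /mask; case: ifP => //; rewrite mxE.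
apply: measurable_fun_if => //.
- exact: measurable_feasible.
- by apply: measurable_fun_ltr => //; exact: (wp_measurable_p wp).
Qed.

Lemma measurable_section (f : borel_cV R d * Z -> R) q : K q ->
  measurable_fun (feasible K) f -> measurable_fun setT (fun z => f (q, z)).
Proof.
move=> Kq mf.
apply: (measurable_comp (F := feasible K) measurable_feasible _ mf).
  by move=> _ [z _ <-].
exact: measurable_fun_pair.
Qed.

Lemma hess_estE q z i j : hess_est p Ft q z i j =
  Ft q z * (score p q z i 0 * score p q z j 0) + hess_Ft Ft q z i j
  + grad_Ft Ft q z i 0 * score p q z j 0 + Ft q z * hess_log p q z i j
  + score p q z i 0 * grad_Ft Ft q z j 0.
Proof.
have outerE (u v : 'cV[R]_d) : (u *m v^T) i j = u i 0 * v j 0.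
  by rewrite mxE big_ord1 [v^T _ _]mxE.
have addE (A A' : 'M[R]_d) : (A + A') i j = A i j + A' i j by rewrite mxE.
have scaleE k (A : 'M[R]_d) : (k *: A) i j = k * A i j by rewrite mxE.
rewrite /hess_est; move: (score p q z) (grad_Ft Ft q z) => s g.
move: (hess_Ft Ft q z) (hess_log p q z) => H l.
by rewrite !addE !scaleE !outerE.
Qed.

Lemma measurable_hess_est : measurable_on (feasible K) (mask (hess_est p Ft)).
Proof.
apply: measurable_mask => i j; under eq_fun do rewrite hess_estE.
have pK : positive p K `<=` feasible K by move=> xz [].
have mFt : measurable_fun (positive p K)
    (fun xz : borel_cV R d * Z => Ft xz.1 xz.2).
  apply: measurable_funS (wp_measurable_Ft wp) => //.
  exact: measurable_feasible.
have mg k : measurable_fun (positive p K)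
    (fun xz : borel_cV R d * Z => grad_Ft Ft xz.1 xz.2 k 0).
  apply: measurable_funS (wp_measurable_grad wp k 0) => //.
  exact: measurable_feasible.
have mh : measurable_fun (positive p K)
    (fun xz : borel_cV R d * Z => hess_Ft Ft xz.1 xz.2 i j).
  apply: measurable_funS (wp_measurable_hess wp i j) => //.
  exact: measurable_feasible.
have ms k := wp_measurable_score wp k 0.
have ml := wp_measurable_hess_log wp i j.
apply: measurable_funD; last exact: measurable_funM (ms i) (mg j).
apply: measurable_funD; last exact: measurable_funM mFt ml.
apply: measurable_funD; last exact: measurable_funM (mg i) (ms j).
apply: measurable_funD; last exact: mh.
exact: measurable_funM mFt (measurable_funM (ms i) (ms j)).
Qed.

Lemma hess_est_mulmx q z h : hess_est p Ft q z *m h =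
  (Ft q z * inner (score p q z) h) *: score p q z + hess_Ft Ft q z *m h
  + inner (score p q z) h *: grad_Ft Ft q z + Ft q z *: (hess_log p q z *m h)
  + inner (grad_Ft Ft q z) h *: score p q z.
Proof.
rewrite /hess_est; move: (score p q z) (grad_Ft Ft q z) => s g.
move: (hess_Ft Ft q z) (hess_log p q z) => H l.
by rewrite !mulmxDl -!scalemxAl !outer_mulmx scalerA.
Qed.

Variables (B GF Gp LF Lp : R).
Hypothesis FtB : forall y s, K y -> `|Ft y s| <= B.
Hypothesis gradGF : forall y s, K y -> enorm (grad_Ft Ft y s) <= GF.
Hypothesis Gp0 : 0 <= Gp.
Hypothesis scoreGp : forall y, K y ->
  (moment mu p y (fun s => enorm (score p y s) ^+ 4)%R <= (Gp ^+ 4)%:E)%E.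
Hypothesis hessLF : forall y s, K y -> spectral_norm (hess_Ft Ft y s) <= LF.
Hypothesis Lp0 : 0 <= Lp.
Hypothesis hess_logLp : forall y, K y ->
  (moment mu p y (fun s => spectral_norm (hess_log p y s) ^+ 2)%R
    <= (Lp ^+ 2)%:E)%E.

Local Notation G := (Num.max GF Gp).
Local Notation L := (Num.max LF Lp).
Local Notation Lbar2 := (4 * B ^+ 2 * G ^+ 4 + 16 * G ^+ 4 + 4 * L ^+ 2
  + 4 * B ^+ 2 * L ^+ 2).

Lemma Lbar2_ge0 : 0 <= Lbar2.
Proof.
have G4 : 0 <= G ^+ 4 by rewrite -[4%N]/(2 * 2)%N exprM sqr_ge0.
have B2 := sqr_ge0 B; have L2 := sqr_ge0 L.
have := mulr_ge0 B2 G4; have := mulr_ge0 B2 L2; lra.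
Qed.

Lemma enorm_hess_est q z h : K q ->
  enorm (hess_est p Ft q z *m h) <=
  B * enorm (score p q z) ^+ 2 * enorm h + LF * enorm h
  + 2 * GF * enorm (score p q z) * enorm h
  + B * enorm (hess_log p q z *m h).
Proof.
move=> Kq; rewrite hess_est_mulmx.
have B0 : 0 <= B by exact: le_trans (FtB z Kq).
have GF0 : 0 <= GF by exact: le_trans (enorm_ge0 _) (gradGF z Kq).
have := FtB z Kq; have := gradGF z Kq; have := hessLF z Kq.
move: (score p q z) (grad_Ft Ft q z) (hess_Ft Ft q z) (hess_log p q z) (Ft q z).
move=> s g H l f HLF gGF fB.
have e1 : enorm ((f * inner s h) *: s) <= B * enorm s ^+ 2 * enorm h.
  rewrite enormZ normrM -!mulrA ler_pM ?mulr_ge0 ?enorm_ge0 ?fB//.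
  rewrite mulrC ler_wpM2l ?enorm_ge0//.
  exact: cauchy_schwarz_norm.
have e2 : enorm (H *m h) <= LF * enorm h.
  by rewrite (le_trans (enorm_mulmx _ _))// ler_wpM2r ?enorm_ge0.
have e3 : enorm (inner s h *: g) <= GF * enorm s * enorm h.
  rewrite enormZ mulrC -mulrA ler_pM ?enorm_ge0//.
  exact: cauchy_schwarz_norm.
have e4 : enorm (f *: (l *m h)) <= B * enorm (l *m h).
  by rewrite enormZ ler_wpM2r ?enorm_ge0.
have e5 : enorm (inner g h *: s) <= GF * enorm s * enorm h.
  rewrite enormZ mulrAC ler_wpM2r ?enorm_ge0//.
  by rewrite (le_trans (cauchy_schwarz_norm _ _))// ler_wpM2r ?enorm_ge0.
have := ler_enormD ((f * inner s h) *: s) (H *m h).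
have := ler_enormD ((f * inner s h) *: s + H *m h)
  (inner s h *: g).
have := ler_enormD ((f * inner s h) *: s + H *m h
  + inner s h *: g) (f *: (l *m h)).
have := ler_enormD ((f * inner s h) *: s + H *m h
  + inner s h *: g + f *: (l *m h)) (inner g h *: s).
lra.
Qed.

(** When the previous bound is squared, the norm [s] of the score in the term
    [2 * GF * s] is brought to the fourth power, the one whose mean is
    controlled, by [2 * (GF * s) ^+ 2 <= GF ^+ 4 + s ^+ 4]. *)
Lemma enorm_hess_est_sqr q z h : K q ->
  enorm (mask (hess_est p Ft) q z *m h) ^+ 2 <=
  (4 * B ^+ 2 + 8) * enorm h ^+ 2 * enorm (mask (score p) q z) ^+ 4
  + 4 * B ^+ 2 * enorm (mask (hess_log p) q z *m h) ^+ 2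
  + (4 * LF ^+ 2 + 8 * G ^+ 4) * enorm h ^+ 2.
Proof.
move=> Kq; have GF0 : 0 <= GF by exact: le_trans (enorm_ge0 _) (gradGF z Kq).
have LF0 : 0 <= LF by exact: le_trans (spectral_norm_ge0 _) (hessLF z Kq).
have h0 := enorm_ge0 h.
rewrite /mask; case: ifP => _; last first.
  rewrite !mul0mx enorm0 !expr0n/= !mulr0 !add0r mulr_ge0 ?sqr_ge0//.
  have G4 : 0 <= G ^+ 4 by rewrite exprn_ge0// le_max GF0.
  by have := sqr_ge0 LF; lra.
have := enorm_hess_est z h Kq.
have := enorm_ge0 (hess_est p Ft q z *m h).
have := enorm_ge0 (score p q z); have := enorm_ge0 (hess_log p q z *m h).
move: (hess_est p Ft q z *m h) (score p q z) (hess_log p q z *m h) h0.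
move=> Hh sc lh h0; have : GF ^+ 4 <= G ^+ 4.
  by rewrite lerXn2r ?nnegrE ?le_max ?GF0 ?lexx.
move: (enorm Hh) (enorm sc) (enorm lh) (enorm h) h0 => H s l e e0.
move=> GF4 l0 s0 H0 Hle.
have {Hle} : H ^+ 2 <=
    (B * s ^+ 2 * e + LF * e + 2 * GF * s * e + B * l) ^+ 2.
  by rewrite lerXn2r ?nnegrE ?(le_trans H0).
move/le_trans; apply.
have sq4 (t u v w : R) :
    (t + u + v + w) ^+ 2 <= 4 * (t ^+ 2 + u ^+ 2 + v ^+ 2 + w ^+ 2).
  have := sqr_ge0 (t - u); have := sqr_ge0 (t - v); have := sqr_ge0 (t - w).
  have := sqr_ge0 (u - v); have := sqr_ge0 (u - w); have := sqr_ge0 (v - w).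
  nra.
apply: le_trans (sq4 _ _ _ _) _.
have : (2 * GF * s * e) ^+ 2 <= (2 * G ^+ 4 + 2 * s ^+ 4) * e ^+ 2.
  rewrite exprMn ler_wpM2r ?sqr_ge0//.
  have := sqr_ge0 (GF ^+ 2 - s ^+ 2); nra.
by have := sqr_ge0 (B * l); nra.
Qed.


Lemma has_mean_score q : K q -> exists2 r,
  has_mean mu p q (fun z => enorm (mask (score p) q z) ^+ 4) r & r <= Gp ^+ 4.
Proof.
move=> Kq; have pq := wp_density wp (KO Kq).
have ms : measurable_vec setT (mask (score p) q).
  move=> i.
  apply: (measurable_section Kq (f := fun xz => mask (score p) xz.1 xz.2 i 0)).
  exact: measurable_mask (wp_measurable_score wp) i 0.
apply: has_mean_ge0 => // [|z|].
- under eq_fun do rewrite -[4%N]/(2 * 2)%N exprM enorm_sqr.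
  apply: measurable_funM; last by case: pq.
  by apply: measurable_funX; exact: measurable_inner.
- by rewrite exprn_ge0 ?enorm_ge0.
- apply: le_trans (scoreGp Kq); rewrite le_eqVlt; apply/orP; left; apply/eqP.
  apply: eq_integral => z _; congr EFin.
  by rewrite (maskM (score p) z (fun u => enorm u ^+ 4)).
Qed.

Lemma has_mean_hess_log q h : K q -> exists2 r,
  has_mean mu p q (fun z => enorm (mask (hess_log p) q z *m h) ^+ 2) r &
  r <= Lp ^+ 2 * enorm h ^+ 2.
Proof.
move=> Kq; have pq := wp_density wp (KO Kq).
have ml i j : measurable_fun setT (fun z => mask (hess_log p) q z i j).
  apply: (measurable_section Kq (f := fun xz => mask (hess_log p) xz.1 xz.2 i j)).
  exact: measurable_mask (wp_measurable_hess_log wp) i j.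
apply: has_mean_ge0 => // [|z|].
- under eq_fun do rewrite enorm_sqr.
  apply: measurable_funM; last by case: pq.
  by apply: measurable_inner; apply: measurable_vec_mulmx => //;
    exact: measurable_vec_cst.
- by rewrite sqr_ge0.
(* division by [enorm h ^+ 2] isolates the spectral norm, which need not be
   measurable, on the larger side *)
have [h0|h0] := eqVneq (enorm h) 0.
  rewrite integral0_eq ?h0 ?expr0n/= ?mulr0// => z _.
  have := enorm_mulmx (mask (hess_log p) q z) h; rewrite h0 mulr0 => le0.
  have -> : enorm (mask (hess_log p) q z *m h) = 0.
    by apply/eqP; rewrite eq_le le0 enorm_ge0.
  by rewrite expr0n mul0r.
have hp : 0 < enorm h ^+ 2 by rewrite exprn_gt0// lt_def h0 enorm_ge0.
rewrite mulrC EFinM -lee_pdivrMl// -ge0_integralZl//; last 3 first.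
- apply/measurable_EFinP; under eq_fun do rewrite enorm_sqr.
  apply: measurable_funM; last by case: pq.
  by apply: measurable_inner; apply: measurable_vec_mulmx => //;
    exact: measurable_vec_cst.
- by move=> z _; rewrite lee_fin mulr_ge0 ?sqr_ge0// density_ge0.
- by rewrite lee_fin invr_ge0 ltW.
apply: le_trans (hess_logLp Kq); apply: ge0_le_integral_any => z.
  rewrite mule_ge0// lee_fin ?invr_ge0 ?(ltW hp)//.
  by rewrite mulr_ge0 ?sqr_ge0// density_ge0.
rewrite -EFinM lee_fin.
rewrite (maskM (hess_log p) z (fun A => enorm (A *m h) ^+ 2))//.
rewrite mulrA ler_wpM2r ?density_ge0// mulrC ler_pdivrMr// -exprMn.
rewrite lerXn2r ?nnegrE ?enorm_ge0 ?mulr_ge0 ?spectral_norm_ge0 ?enorm_ge0//.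
exact: enorm_mulmx.
Qed.

(** The four terms of [Lbar2] bound the means of the squares of the four groups
    of terms in [enorm_hess_est], each multiplied by [4]. *)
Lemma has_mean_hess_est_sqr q h : K q -> exists2 r,
  has_mean mu p q (fun z => enorm (mask (hess_est p Ft) q z *m h) ^+ 2) r &
  r <= Lbar2 * enorm h ^+ 2.
Proof.
move=> Kq; have pq := wp_density wp (KO Kq).
have [r4 mean4 r4le] := has_mean_score Kq.
have [r2 mean2 r2le] := has_mean_hess_log h Kq.
have meanub := has_meanD (has_meanD
  (has_meanZ ((4 * B ^+ 2 + 8) * enorm h ^+ 2) mean4)
  (has_meanZ (4 * B ^+ 2) mean2))
  (has_mean_cst pq ((4 * LF ^+ 2 + 8 * G ^+ 4) * enorm h ^+ 2)).
have mH i j : measurable_fun setT (fun z => mask (hess_est p Ft) q z i j).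
  apply: (measurable_section Kq
    (f := fun xz => mask (hess_est p Ft) xz.1 xz.2 i j)).
  exact: measurable_hess_est.
have [r meanr] : exists r,
    has_mean mu p q (fun z => enorm (mask (hess_est p Ft) q z *m h) ^+ 2) r.
  apply: (has_mean_bounded pq _ _ meanub) => [|z].
    under eq_fun do rewrite enorm_sqr.
    apply: measurable_funM; last by case: pq.
    by apply: measurable_inner; apply: measurable_vec_mulmx => //;
      exact: measurable_vec_cst.
  by rewrite ger0_norm ?sqr_ge0// enorm_hess_est_sqr.
exists r => //; apply: le_trans (has_mean_le _ meanr meanub) _ => [z|].
  by rewrite ler_wpM2r ?density_ge0// enorm_hess_est_sqr.
have GF0 : 0 <= GF := le_trans (enorm_ge0 _) (gradGF point Kq).
have LF0 : 0 <= LF := le_trans (spectral_norm_ge0 _) (hessLF point Kq).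
have Gp4 : Gp ^+ 4 <= G ^+ 4.
  by rewrite lerXn2r ?nnegrE ?le_max ?GF0 ?lexx ?orbT.
have LF2 : LF ^+ 2 <= L ^+ 2 by rewrite lerXn2r ?nnegrE ?le_max ?LF0 ?lexx.
have Lp2 : Lp ^+ 2 <= L ^+ 2.
  by rewrite lerXn2r ?nnegrE ?le_max ?LF0 ?lexx ?orbT.
have h2 := sqr_ge0 (enorm h); have B2 := sqr_ge0 B.
have s1 : (4 * B ^+ 2 + 8) * enorm h ^+ 2 * r4 <=
    (4 * B ^+ 2 + 8) * enorm h ^+ 2 * G ^+ 4.
  by rewrite ler_wpM2l ?(le_trans r4le)// mulr_ge0// addr_ge0// mulr_ge0.
have s2 : 4 * B ^+ 2 * r2 <= 4 * B ^+ 2 * (L ^+ 2 * enorm h ^+ 2).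
  have r2L : r2 <= L ^+ 2 * enorm h ^+ 2.
    by apply: le_trans r2le _; rewrite ler_wpM2r.
  by rewrite ler_wpM2l// mulr_ge0.
have s3 : LF ^+ 2 * enorm h ^+ 2 <= L ^+ 2 * enorm h ^+ 2 by rewrite ler_wpM2r.
lra.
Qed.

Local Notation F := (objective mu p Ft).
Hypothesis unbiased_grad :
  forall y, K y -> mx_expect mu p y (grad_Ft Ft y) = grad F y.
Hypothesis unbiased_hess :
  forall y, K y -> mx_expect mu p y (hess_est p Ft y) = hess F y.

Lemma has_mean_inner_grad q c : K q ->
  has_mean mu p q (fun z => inner c (grad_Ft Ft q z)) (inner c (grad F q)).
Proof.
move=> Kq; have pq := wp_density wp (KO Kq).
have meani i : has_mean mu p q (fun z => grad_Ft Ft q z i 0) (grad F q i 0).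
  have [r meanr] : exists r, has_mean mu p q (fun z => grad_Ft Ft q z i 0) r.
    apply: (has_mean_bounded pq _ _ (has_mean_cst pq GF)) => [|z].
      apply: measurable_funM; last by case: pq.
      apply: (measurable_section Kq (f := fun xz => grad_Ft Ft xz.1 xz.2 i 0)).
      exact: (wp_measurable_grad wp i 0).
    exact: le_trans (ler_coord_enorm _ _) (gradGF z Kq).
  suff -> : grad F q i 0 = r by [].
  by rewrite -unbiased_grad// mxE; exact: has_mean_expect.
rewrite innerE; under [X in has_mean _ _ _ X]eq_fun do rewrite innerE.
apply: (has_mean_sum pq) => i; exact: has_meanZ.
Qed.

Lemma has_mean_inner_hess q c h : K q ->
  has_mean mu p q (fun z => inner c (mask (hess_est p Ft) q z *m h))
    (inner c (hess F q *m h)).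
Proof.
move=> Kq; have pq := wp_density wp (KO Kq).
have meanij i j : has_mean mu p q (fun z => mask (hess_est p Ft) q z i j)
    (hess F q i j).
  have [r2 mean2 _] := has_mean_hess_est_sqr (delta_mx j 0) Kq.
  have [r meanr] : exists r,
      has_mean mu p q (fun z => mask (hess_est p Ft) q z i j) r.
    apply: (has_mean_bounded pq _ _ (has_meanD (has_mean_cst pq 1) mean2)) => [|z].
      apply: measurable_funM; last by case: pq.
      apply: (measurable_section Kq
    (f := fun xz => mask (hess_est p Ft) xz.1 xz.2 i j)).
      exact: measurable_hess_est.
    have -> : mask (hess_est p Ft) q z i j =
        (mask (hess_est p Ft) q z *m delta_mx j (0 : 'I_1)) i 0.
      by rewrite -colE mxE.
    apply: le_trans (ler_coord_enorm _ _) _.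
    by set e := enorm _; have := sqr_ge0 (e - 1); nra.
  suff -> : hess F q i j = r by [].
  rewrite -unbiased_hess// mxE -(has_mean_expect meanr).
  rewrite /expect; congr fine; apply: eq_integral => z _.
  by rewrite (maskM (hess_est p Ft) z (fun A => A i j)).
rewrite innerE; under [X in has_mean _ _ _ X]eq_fun do rewrite innerE.
apply: (has_mean_sum pq) => i; apply: has_meanZ; rewrite mxE.
under [X in has_mean _ _ _ X]eq_fun do rewrite mxE.
apply: (has_mean_sum pq) => j.
under [X in has_mean _ _ _ X]eq_fun do rewrite mulrC.
by rewrite mulrC; exact: has_meanZ.
Qed.

Lemma enorm_grad_objective q : K q -> enorm (grad F q) <= GF.
Proof.
move=> Kq; have pq := wp_density wp (KO Kq).
apply: enorm_le_self; first exact: le_trans (enorm_ge0 _) (gradGF point Kq).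
apply: has_mean_le (has_mean_inner_grad _ Kq) (has_mean_cst pq _) => z.
rewrite ler_wpM2r ?density_ge0// mulrC (le_trans (cauchy_schwarz _ _))//.
by rewrite ler_wpM2l ?enorm_ge0// gradGF.
Qed.

(** Jensen's inequality for the mean of the estimator, tested against the mean
    itself. *)
Lemma enorm_hess_objective q h : K q ->
  enorm (hess F q *m h) <= Num.sqrt Lbar2 * enorm h.
Proof.
move=> Kq; have pq := wp_density wp (KO Kq).
set c := hess F q *m h.
have [r2 mean2 r2le] := has_mean_hess_est_sqr h Kq.
have : 2 * inner c c <= inner c c + r2.
  apply: has_mean_le (has_meanZ 2 (has_mean_inner_hess c h Kq))
    (has_meanD (has_mean_cst pq (inner c c)) mean2) => z.
  rewrite ler_wpM2r ?density_ge0// enorm_sqr.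
  have := inner_ge0 (c - mask (hess_est p Ft) q z *m h).
  rewrite !inner_simpl (innerC _ c); lra.
rewrite -enorm_sqr => c2.
rewrite -(ler_pXn2r (n := 2))// ?nnegrE ?mulr_ge0 ?enorm_ge0 ?sqrtr_ge0//.
rewrite exprMn (sqr_sqrtr Lbar2_ge0); apply: le_trans r2le.
by move: c2; rewrite mulr_natl mulr2n lerD2l.
Qed.


(** * One step of the recursion *)

Hypothesis convK : convex_set K.
Hypothesis F2 : forall y, K y -> twice_differentiable F y.
Local Notation Lbar := (Num.sqrt Lbar2).

(** The recursion of the gradient estimate, rewritten for its difference with the
    gradient. The query point [q] is a separate argument because the means over
    the sample and over the query point are taken one after the other. *)
Definition next_error (rho : R) (X X' e q : 'cV[R]_d) (z : Z) : 'cV[R]_d :=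
  (1 - rho) *: e
  + (1 - rho) *: (mask (hess_est p Ft) q z *m (X - X') - (grad F X - grad F X'))
  + rho *: (grad_Ft Ft X z - grad F X).

Lemma grad_Ft_lipschitz X Y z : K X -> K Y ->
  enorm (grad_Ft Ft X z - grad_Ft Ft Y z) <= LF * enorm (X - Y).
Proof.
move=> KX KY; apply: (grad_lipschitz convK) => //.
- by move=> y Ky; exact: (wp_diff_Ft wp).
- exact: le_trans (spectral_norm_ge0 _) (hessLF z KX).
- move=> y h Ky; apply: le_trans (enorm_mulmx _ _) _.
  by rewrite ler_wpM2r ?enorm_ge0// hessLF.
Qed.

Lemma grad_objective_lipschitz X Y : K X -> K Y ->
  enorm (grad F X - grad F Y) <= Lbar * enorm (X - Y).
Proof.
move=> KX KY; apply: (grad_lipschitz convK) => //.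
by move=> y h Ky; exact: enorm_hess_objective.
Qed.

Lemma enorm_sqrD3_le (u a s : 'cV[R]_d) :
  enorm (u + a + s) ^+ 2 <=
  enorm u ^+ 2 + 2 * inner u a + 2 * inner u s
  + 2 * enorm a ^+ 2 + 2 * enorm s ^+ 2.
Proof.
rewrite !enorm_sqr; have := inner_ge0 (a - s).
rewrite !inner_simpl (innerC a u) (innerC s u) (innerC s a); lra.
Qed.

(** The first part of the bound is affine in the estimator and in the gradient
    at the query point, whose means are known. The sample is drawn at [q] and
    not at [X], so the term [grad_Ft Ft X z] is biased; it is replaced by
    [grad_Ft Ft q z] at the cost of a Lipschitz error. *)
Lemma next_error_le rho X X' e q z U D : 0 <= rho <= 1 -> K X -> K X' -> K q ->
  enorm (X - q) <= enorm (X - X') ->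
  U = (1 - rho) *: e -> D = grad F X - grad F X' ->
  enorm (next_error rho X X' e q z) ^+ 2 <=
  enorm U ^+ 2 - 2 * (1 - rho) * inner U D
  + 2 * rho * (enorm U * LF * enorm (X - X') - inner U (grad F X))
  + 2 * (1 - rho) ^+ 2 * enorm D ^+ 2 + 8 * rho ^+ 2 * GF ^+ 2
  + inner ((2 * (1 - rho)) *: U - (4 * (1 - rho) ^+ 2) *: D)
      (mask (hess_est p Ft) q z *m (X - X'))
  + 2 * rho * inner U (grad_Ft Ft q z)
  + 2 * (1 - rho) ^+ 2 * enorm (mask (hess_est p Ft) q z *m (X - X')) ^+ 2.
Proof.
move=> /andP[rho0 rho1] KX KX' Kq Xq UE DE.
have LF0 : 0 <= LF := le_trans (spectral_norm_ge0 _) (hessLF z KX).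
have lip : inner U (grad_Ft Ft X z - grad_Ft Ft q z)
    <= enorm U * LF * enorm (X - X').
  rewrite (le_trans (cauchy_schwarz _ _))// -mulrA ler_wpM2l ?enorm_ge0//.
  by rewrite (le_trans (grad_Ft_lipschitz z KX Kq))// ler_wpM2l.
have dev : enorm (grad_Ft Ft X z - grad F X) ^+ 2 <= 4 * GF ^+ 2.
  have e1 := gradGF z KX; have e2 := enorm_grad_objective KX.
  have e3 := le_trans (ler_enormB _ _) (lerD e1 e2).
  have e4 := enorm_ge0 (grad_Ft Ft X z - grad F X).
  by move: (enorm _) e3 e4 => t; nra.
rewrite /next_error -UE -DE; move: lip dev => {UE DE}.
move: (mask (hess_est p Ft) q z *m (X - X')) (enorm (X - X')) => H n.
move: (grad_Ft Ft X z) (grad_Ft Ft q z) (grad F X) U D => gX gq gF u {}D.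
rewrite !inner_simpl => lip dev; apply: le_trans (enorm_sqrD3_le _ _ _) _.
rewrite !enormZ (ger0_norm rho0) ger0_norm ?subr_ge0// !exprMn.
have r2 := ler_wpM2l (sqr_ge0 rho) dev; have r1 := ler_wpM2l rho0 lip.
rewrite (enorm_sqr (H - D)) (enorm_sqr H) (enorm_sqr D) !inner_simpl (innerC H D).
move: (enorm (gX - gF)) (enorm u) (inner u gX) (inner u gq) (inner u gF) r1 r2.
move: (inner u H) (inner u D) (inner D H) (inner H H) (inner D D).
move=> t1 t2 t3 t4 t5 t6 t7 t8 t9 t10 r1 r2.
lra.
Qed.

(** Clamping keeps the point in [K] for every real parameter, so that functions of
    the parameter can be measurable on the whole line. *)
Definition segment_point X X' (s : R) : 'cV[R]_d := X' + clamp s *: (X - X').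

Lemma segment_pointK X X' s : K X -> K X' -> K (segment_point X X' s).
Proof. by move=> KX KX'; apply: convex_set_segment => //; exact: clamp_itv. Qed.

(** Averaging first over the sample and then over the query point. The mean of
    the Hessian term over the segment is [inner c D] exactly, by the
    fundamental theorem of calculus, and this is what cancels both the first
    order term in [U] and the mean of the estimator. *)
Lemma mean_next_error_le rho X X' e : 0 <= rho <= 1 -> K X -> K X' ->
  (\int[lebesgue_measure]_(s in `[(0%R : R), 1%R]) \int[mu]_z
    (enorm (next_error rho X X' e (segment_point X X' s) z) ^+ 2
      * p (segment_point X X' s) z)%:E <=
  ((1 - rho) ^+ 2 * enorm e ^+ 2
   + 2 * rho * (1 - rho) * enorm e * (LF + Lbar) * enorm (X - X')
   + 8 * rho ^+ 2 * GF ^+ 2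
   + 2 * (1 - rho) ^+ 2 * Lbar2 * enorm (X - X') ^+ 2)%:E)%E.
Proof.
move=> rho01 KX KX'; have /andP[rho0 rho1] := rho01.
pose U := (1 - rho) *: e; pose D := grad F X - grad F X'.
pose c := (2 * (1 - rho)) *: U - (4 * (1 - rho) ^+ 2) *: D.
pose h := X - X'.
pose k2 := enorm U ^+ 2 - 2 * (1 - rho) * inner U D
  + 2 * rho * (enorm U * (LF + Lbar) * enorm h)
  + 2 * (1 - rho) ^+ 2 * enorm D ^+ 2 + 8 * rho ^+ 2 * GF ^+ 2
  + 2 * (1 - rho) ^+ 2 * (Lbar2 * enorm h ^+ 2).
have inner_le (s : R) : 0 <= s <= 1 ->
  (\int[mu]_z (enorm (next_error rho X X' e (segment_point X X' s) z) ^+ 2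
      * p (segment_point X X' s) z)%:E
   <= (k2 + inner c (hess F (X' + s *: h) *m h))%:E)%E.
  move=> s01; have Kq := segment_pointK s KX KX'.
  have qE : segment_point X X' s = X' + s *: h by rewrite /segment_point clamp_id.
  move: (segment_point X X' s) Kq qE => q Kq qE; rewrite -qE.
  have pq := wp_density wp (KO Kq).
  have Xq : enorm (X - q) <= enorm h.
    have -> : X - q = (1 - s) *: h.
      by rewrite qE opprD addrA scalerBl scale1r.
    have /andP[s0 s1] := s01.
    rewrite enormZ ger0_norm ?subr_ge0// -[leRHS]mul1r.
    by rewrite ler_wpM2r ?enorm_ge0// lerBlDl lerDr.
  have [r2 mean2 r2le] := has_mean_hess_est_sqr h Kq.
  have [_ meanE] := has_meanD (has_meanD (has_meanD (has_mean_cst pq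
      (enorm U ^+ 2 - 2 * (1 - rho) * inner U D
      + 2 * rho * (enorm U * LF * enorm h - inner U (grad F X))
      + 2 * (1 - rho) ^+ 2 * enorm D ^+ 2 + 8 * rho ^+ 2 * GF ^+ 2))
    (has_mean_inner_hess c h Kq))
    (has_meanZ (2 * rho) (has_mean_inner_grad U Kq)))
    (has_meanZ (2 * (1 - rho) ^+ 2) mean2).
  move: meanE; set ub := (fun z => (_ * p q z)%:E) => meanE.
  apply: le_trans (ge0_le_integral_any mu (g := ub) _ _) _ => [z|z|].
  - by rewrite lee_fin mulr_ge0 ?sqr_ge0// density_ge0.
  - rewrite lee_fin; apply: ler_wpM2r; first exact: density_ge0.
    exact: (next_error_le (U := U) (D := D) (e := e) z rho01 KX KX' Kq Xq).
  rewrite meanE lee_fin /k2.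
  have lip : inner U (grad F q) - inner U (grad F X) <= enorm U * Lbar * enorm h.
    rewrite -innerNr -innerDr (le_trans (cauchy_schwarz _ _))// -mulrA.
    rewrite ler_wpM2l ?enorm_ge0// (le_trans (grad_objective_lipschitz Kq KX))//.
    by rewrite ler_wpM2l ?sqrtr_ge0// -opprB enormN.
  have r1 := ler_wpM2l rho0 lip; have r3 := ler_wpM2l (sqr_ge0 (1 - rho)) r2le.
  move: (inner c _) r1 r3 {lip} => t; move: Lbar Lbar2 => Lb Lb2.
  move: (inner U D) (inner U (grad F X)) (inner U (grad F q)) (enorm U) (enorm h).
  move: (enorm D) => t1 t2 t3 t4 t5 t6 r1 r3.
  lra.
apply: le_trans (ge0_le_integral_any_in lebesgue_measure
  (g := fun s : R => (k2 + inner c (hess F (X' + s *: h) *m h))%:E) _ _) _.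
- move=> s _; apply: integral_ge0 => z _.
  by rewrite lee_fin mulr_ge0 ?sqr_ge0// density_ge0//; exact: segment_pointK.
- by move=> s; rewrite /= in_itv/=; exact: inner_le.
have hessL y u : K y -> enorm (hess F y *m u) <= Lbar * enorm u.
  by move=> Ky; exact: enorm_hess_objective.
have [ic icE] := integral_hess_segment convK F2 hessL c KX KX'.
have ik : lebesgue_measure.-integrable `[(0%R : R), 1%R] (cst k2%:E : R -> \bar R).
  apply/integrableP; split => //; rewrite integral_cst//=.
  by rewrite lebesgue_measure_itv/= lte_fin ltr01 -EFinB -EFinM ltry.
under eq_integral do rewrite EFinD.
rewrite integralD// icE integral_cst//= lebesgue_measure_itv/= lte_fin ltr01.
rewrite oppr0 adde0 mule1 -EFinD lee_fin /k2 -/D -/h {ic icE ik inner_le k2}.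
have UE : enorm U = (1 - rho) * enorm e by rewrite enormZ ger0_norm ?subr_ge0.
rewrite /c {c}; move: U D UE => u {}D ->.
have D2 := sqr_ge0 ((1 - rho) * enorm D).
rewrite !inner_simpl -(enorm_sqr D); move: D2; move: Lbar Lbar2 => Lb Lb2.
move: (inner u D) (enorm e) (enorm D) (enorm h) => t1 t2 t3 t4 D2.
lra.
Qed.

(** * Measurability along a trajectory *)

Lemma measurable_feasible_comp dT (T : measurableType dT) (q : T -> 'cV[R]_d)
    (zz : T -> Z) (f : borel_cV R d * Z -> R) :
  measurable_fun (feasible K) f -> measurable_vec setT q ->
  measurable_fun setT zz -> (forall t, K (q t)) ->
  measurable_fun setT (fun t => f (q t, zz t)).
Proof.
move=> mf mq mz Kq.
apply: (measurable_comp (F := feasible K) measurable_feasible _ mf).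
  by move=> _ [t _ <-]; exact: Kq.
by apply: measurable_fun_pair => //; exact: measurable_fun_borel.
Qed.

Lemma measurable_vec_grad_objective dT (T : measurableType dT)
    (q : T -> 'cV[R]_d) :
  measurable_vec setT q -> (forall t, K (q t)) ->
  measurable_vec setT (fun t => grad F (q t)).
Proof.
move=> mq Kq i.
have mg : measurable_fun (K : set (borel_cV R d))
    (fun y : borel_cV R d => grad F y i 0).
  apply: measurable_fun_continuous_on => y Ky; have [_ dg] := F2 Ky.
  exact: (continuous_comp (differentiable_continuous dg)
    (@coord_continuous _ _ _ i 0 _)).
have qK : (q : T -> borel_cV R d) @` setT `<=` K by move=> _ [t _ <-].
exact: (measurable_comp mK qK mg (measurable_fun_borel mq)).
Qed.

Lemma measurable_next_error dT (T : measurableType dT) rho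
    (X X' e q : T -> 'cV[R]_d) (zz : T -> Z) :
  measurable_vec setT X -> measurable_vec setT X' -> measurable_vec setT e ->
  measurable_vec setT q -> measurable_fun setT zz ->
  (forall t, K (X t)) -> (forall t, K (X' t)) -> (forall t, K (q t)) ->
  measurable_vec setT
    (fun t => next_error rho (X t) (X' t) (e t) (q t) (zz t)).
Proof.
move=> mX mX' me mq mz KX KX' Kq.
have mcst k : measurable_fun setT (fun _ : T => k : R) by exact: measurable_cst.
apply: measurable_vecD; first apply: measurable_vecD.
- exact: measurable_vecZ.
- apply: measurable_vecZ => //; apply: measurable_vecB; last first.
    by apply: measurable_vecB; exact: measurable_vec_grad_objective.
  apply: measurable_vec_mulmx; last exact: measurable_vecB.
  move=> i j; apply: (measurable_feasible_comp
    (f := fun xz => mask (hess_est p Ft) xz.1 xz.2 i j)) => //.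
  exact: measurable_hess_est.
- apply: measurable_vecZ => //; apply: measurable_vecB.
    move=> i; apply: (measurable_feasible_comp
      (f := fun xz => grad_Ft Ft xz.1 xz.2 i 0)) => //.
    exact: (wp_measurable_grad wp i 0).
  exact: measurable_vec_grad_objective.
Qed.

Variables (rad : R).
Hypothesis Krad : forall y, K y -> enorm y <= rad.
Hypothesis K0 : K 0.
Variables (dO : measure_display) (Om : measurableType dO) (P : probability Om R).
Variables (T : nat) (a : nat -> Om -> R) (z : nat -> Om -> Z).
Variables (x g v : nat -> Om -> 'cV[R]_d).
Hypothesis T0 : (0 < T)%N.
Hypothesis run : sfw_run mu p Ft P a z x g v K T
  (fun t => t.-1%:R^-1) (fun=> T%:R^-1) 0.

(** The point [u] is an average of the directions chosen so far; as [K] contains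
    [0], it also contains the iterate. *)
Lemma iterate_scaled t w : (t <= T)%N ->
  exists2 u, K u & x t.+1 w = (t%:R / T%:R) *: u.
Proof.
elim: t => [_|t ih tT].
  by exists 0 => //; rewrite (run_x1 run) mul0r scale0r.
have [u Ku xE] := ih (ltnW tT).
have tT' : (1 <= t.+1 <= T)%N by [].
have [Kv _] := run_v run w tT'.
exists (u + t.+1%:R^-1 *: (v t.+1 w - u)).
  by apply: convex_set_segment => //; rewrite invr_ge0 ler0n invf_le1 ?ler1n ?ltr0n.
rewrite (run_x run)// xE; apply/colP => i; rewrite !mxE.
have : (T%:R : R) != 0 by rewrite pnatr_eq0 -lt0n.
have : (t.+1%:R : R) != 0 by rewrite pnatr_eq0.
rewrite -natr1 => t0 Tn0; field.
by rewrite t0.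
Qed.

Lemma iterate_in t w : (1 <= t <= T.+1)%N -> K (x t w).
Proof.
case: t => // t; rewrite ltnS => tT.
have [u Ku ->] := iterate_scaled w tT.
rewrite -[_ *: u]add0r -[u in X in K X]subr0; apply: convex_set_segment => //.
have Tp : (0 : R) < T%:R by rewrite ltr0n.
by rewrite divr_ge0 ?ler0n//= ler_pdivrMr// mul1r ler_nat.
Qed.

Lemma step_size t w : (2 <= t <= T)%N ->
  enorm (x t w - x t.-1 w) <= rad / T%:R.
Proof.
case: t => [|[|t]]// /andP[_ tT].
have tT' : (1 <= t.+1 <= T)%N by rewrite /= ltnW.
rewrite (run_x run)//= addrC addKr enormZ ger0_norm ?invr_ge0 ?ler0n//.
rewrite mulrC ler_wpM2r ?invr_ge0 ?ler0n// Krad//.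
by have [] := run_v run w tT'.
Qed.

Lemma query_segment t w : (2 <= t <= T)%N ->
  query a x t w = segment_point (x t w) (x t.-1 w) (a t w).
Proof.
move=> tT; rewrite /query /segment_point clamp_id ?(run_a01 run w tT)//.
by rewrite scalerBl scale1r scalerBr addrCA.
Qed.

Lemma query_in t w : (2 <= t <= T)%N -> K (query a x t w).
Proof.
move=> tT; rewrite query_segment//; apply: segment_pointK; apply: iterate_in.
  by case/andP: tT => t2 tT; rewrite (ltn_trans _ t2)//= leqW.
case: t tT => [|[|t]]// /andP[_ tT]/=; exact: ltnW (leqW tT).
Qed.

Local Notation past := (past a z v).
Local Notation past_and_a := (past_and_a a z v).

Lemma past_id t : <<s past t >> = past t.
Proof. by apply: sigma_algebra_id; exact: smallest_sigma_algebra. Qed.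

Lemma past_and_a_id t : <<s past_and_a t >> = past_and_a t.
Proof. by apply: sigma_algebra_id; exact: smallest_sigma_algebra. Qed.

Lemma past_and_a_sup t : past t `<=` past_and_a t.
Proof. by move=> H pH; apply: sub_sigma_algebra; left. Qed.

Lemma past_measurable t : (t <= T.+1)%N -> past t `<=` measurable.
Proof.
move=> tT; apply: smallest_sub; first exact: sigma_algebra_measurable.
rewrite subUset; split.
  apply: bigcup_sub => s /= /andP[s1 st].
  have sT : (1 <= s <= T)%N by rewrite s1 -ltnS (leq_trans st).
  rewrite subUset; split => _ [A mA <-].
    exact: (run_measurable_z run sT).
  exact: (run_measurable_v run sT).
apply: bigcup_sub => s /= /andP[s1 st] _ [A mA <-].
have sT : (2 <= s <= T)%N by rewrite s1 -ltnS (leq_trans st).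
exact: (run_measurable_a run sT).
Qed.

Lemma past_and_a_measurable t : (2 <= t <= T)%N -> past_and_a t `<=` measurable.
Proof.
move=> tT; apply: smallest_sub; first exact: sigma_algebra_measurable.
rewrite subUset; split.
  by apply: past_measurable; case/andP: tT => _ /leqW.
move=> _ [A mA <-]; exact: (run_measurable_a run tT).
Qed.

Lemma measurable_z_past s t : (1 <= s < t)%N ->
  measurable_fun setT (z s : g_sigma_algebraType (past t) -> Z).
Proof.
move=> st; apply: measurable_fun_generating => H zH.
by apply: sub_sigma_algebra; left; exists s => //; left.
Qed.

Lemma measurable_v_past s t : (1 <= s < t)%N ->
  measurable_fun setT (v s : g_sigma_algebraType (past t) -> borel_cV R d).
Proof.
move=> st; apply: measurable_fun_generating => H zH.
by apply: sub_sigma_algebra; left; exists s => //; right.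
Qed.

Lemma measurable_a_past s t : (2 <= s < t)%N ->
  measurable_fun setT (a s : g_sigma_algebraType (past t) -> R).
Proof.
move=> st; apply: measurable_fun_generating => H zH.
by apply: sub_sigma_algebra; right; exists s.
Qed.

Lemma measurable_a_past_and_a t :
  measurable_fun setT (a t : g_sigma_algebraType (past_and_a t) -> R).
Proof.
apply: measurable_fun_generating => H zH.
by apply: sub_sigma_algebra; right.
Qed.

Lemma measurable_iterate s t : (1 <= s <= t)%N -> (s <= T.+1)%N ->
  measurable_vec setT (x s : g_sigma_algebraType (past t) -> 'cV[R]_d).
Proof.
elim: s => // s ih /andP[_ st] sT.
case: s ih st sT => [_ _ _|s ih st sT].
  have -> : x 1%N = fun=> 0 by apply/funext => w; rewrite (run_x1 run).
  exact: measurable_vec_cst.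
have sT' : (1 <= s.+1 <= T)%N by [].
have -> : x s.+2 = fun w => x s.+1 w + T%:R^-1 *: v s.+1 w.
  by apply/funext => w; rewrite (run_x run).
apply: measurable_vecD; first by apply: ih; rewrite /= ltnW.
apply: measurable_vecZ; first exact: measurable_cst.
move=> i; apply: (measurableT_comp (measurable_coord i)).
exact: measurable_v_past.
Qed.

(** * The error of the gradient estimates *)

(** The error of the gradient estimate of iteration [n.+1], computed with the
    masked Hessian estimator so as to be measurable; see [gradient_error]. *)
Fixpoint error (n : nat) (w : Om) : 'cV[R]_d :=
  if n is m.+1 then
    next_error m.+1%:R^-1 (x m.+2 w) (x m.+1 w) (error m w)
      (query a x m.+2 w) (z m.+2 w)
  else grad_Ft Ft (x 1%N w) (z 1%N w) - grad F (x 1%N w).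

(** Where all the samples have positive density, no mask is active. *)
Lemma gradient_error n w : (n < T)%N ->
  (forall t, (2 <= t <= T)%N -> 0 < p (query a x t w) (z t w)) ->
  g n.+1 w - grad F (x n.+1 w) = error n w.
Proof.
move=> + pos; elim: n => [_|n ih nT]; first by rewrite (run_g1 run).
have nT' : (2 <= n.+2 <= T)%N by [].
rewrite (run_g run w nT')/= /next_error /mask pos// -ih ?(ltnW nT)//.
move: (hess_est p Ft _ _ *m _) (grad_Ft Ft _ _) (grad F (x n.+2 w)) => H gt gX.
move: (grad F (x n.+1 w)) (n.+1%:R^-1) => gX' rho.
by apply/colP => i; rewrite !mxE; ring.
Qed.

Lemma measurable_error n t : (n.+1 < t)%N -> (n < T)%N ->
  measurable_vec setT (error n : g_sigma_algebraType (past t) -> 'cV[R]_d).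
Proof.
elim: n => [|n ih] nt nT.
  have m1 : measurable_vec setT (x 1 : g_sigma_algebraType (past t) -> 'cV[R]_d).
    by apply: measurable_iterate => //; rewrite /= ltnW.
  have K1 w : K (x 1%N w) by exact: iterate_in.
  apply: measurable_vecB; last exact: measurable_vec_grad_objective.
  move=> i; apply: (measurable_feasible_comp
    (f := fun xz => grad_Ft Ft xz.1 xz.2 i 0)) => //.
    exact: (wp_measurable_grad wp i 0).
  exact: measurable_z_past.
have nT' : (2 <= n.+2 <= T)%N by [].
have mX : measurable_vec setT (x n.+2 : g_sigma_algebraType (past t) -> 'cV[R]_d).
  by apply: measurable_iterate; [rewrite /= ltnW|exact: leqW].
have mX' :
    measurable_vec setT (x n.+1 : g_sigma_algebraType (past t) -> 'cV[R]_d).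
  by apply: measurable_iterate; [rewrite /= ltnW// ltnW|rewrite ltnW// leqW].
have ma : measurable_fun setT (a n.+2 : g_sigma_algebraType (past t) -> R).
  exact: measurable_a_past.
apply: measurable_next_error => //.
- by apply: ih; rewrite ltnW.
- apply: measurable_vecD; first exact: measurable_vecZ.
  by apply: measurable_vecZ => //; exact: measurable_funB.
- exact: measurable_z_past.
- by move=> w; apply: iterate_in; rewrite /= leqW.
- by move=> w; apply: iterate_in; rewrite /= ltnW// leqW.
- by move=> w; exact: query_in.
Qed.

Section conditional_laws.
Variable t : nat.
Hypothesis tT : (2 <= t <= T)%N.
Local Notation OmP := (g_sigma_algebraType (past t)).
Local Notation OmA := (g_sigma_algebraType (past_and_a t)).

Let tT1 : (1 <= t <= t)%N. Proof. by case/andP: tT => /ltnW -> _ /=. Qed.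
Let tT2 : (t <= T.+1)%N. Proof. by case/andP: tT => _ /leqW. Qed.
Let tT3 : (1 <= t.-1 <= t)%N.
Proof. by case/andP: tT; case: t => [|[|m]]//= _ _; exact: ltnW. Qed.
Let tT4 : (t.-1 <= T.+1)%N. Proof. exact: leq_trans (leq_pred _) tT2. Qed.

Lemma measurable_id_past : measurable_fun setT (id : OmA -> OmP).
Proof.
move=> _ H; rewrite setTI => pH.
by apply: sub_sigma_algebra; apply: past_and_a_sup; rewrite -past_id.
Qed.

Lemma measurable_segment :
  measurable_vec setT
    (fun ws : OmP * measurableTypeR R =>
      segment_point (x t ws.1) (x t.-1 ws.1) ws.2).
Proof.
have mx s : (1 <= s <= t)%N -> (s <= T.+1)%N ->
    measurable_vec setT (fun ws : OmP * measurableTypeR R => x s ws.1).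
  move=> st sT i.
  exact: (measurableT_comp (measurable_iterate st sT i) measurable_fst).
apply: measurable_vecD; first exact: mx.
apply: measurable_vecZ; last by apply: measurable_vecB; exact: mx.
apply: (measurableT_comp (f := clamp)); last exact: measurable_snd.
exact: continuous_measurable_fun continuous_clamp.
Qed.

Lemma measurable_query : measurable_vec setT (query a x t : OmA -> 'cV[R]_d).
Proof.
have -> : query a x t = fun w => segment_point (x t w) (x t.-1 w) (a t w).
  by apply/funext => w; exact: query_segment.
move=> i; apply: (measurableT_comp (measurable_segment i)
  (g := fun w : OmA => (w : OmP, a t w : measurableTypeR R))).
apply: measurable_fun_pair; first exact: measurable_id_past.
exact: measurable_a_past_and_a.
Qed.

Lemma expect_sample (f : OmA * Z -> \bar R) :
  measurable_fun setT f -> (forall e, (0 <= f e)%E) ->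
  (\int[P]_w f (w, z t w)
    = \int[P]_w \int[mu]_y (f (w, y) * (p (query a x t w) y)%:E))%E.
Proof.
move=> mf f0.
have GO : <<s past_and_a t>> `<=` measurable.
  by rewrite past_and_a_id; exact: past_and_a_measurable.
apply: (integral_conditional_density GO
  (k := fun e : OmA * Z => p (query a x t e.1) e.2)) => //.
- by apply: (run_measurable_z run); case/andP: tT => /ltnW -> ->.
- apply: (measurable_feasible_comp (f := fun xz => p xz.1 xz.2)).
  + exact: (wp_measurable_p wp).
  + move=> i; exact: (measurableT_comp (measurable_query i) measurable_fst).
  + exact: measurable_snd.
  + by move=> e; exact: query_in.
- by move=> e; apply: density_ge0; exact: query_in.
- move=> H A; rewrite past_and_a_id => pH mA; exact: (run_z run).
Qed.

Lemma expect_uniform (f : OmP * measurableTypeR R -> \bar R) :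
  measurable_fun setT f -> (forall e, (0 <= f e)%E) ->
  (\int[P]_w f (w, a t w)
    = \int[P]_w \int[lebesgue_measure]_(s in `[(0%R : R), 1%R]) f (w, s))%E.
Proof.
move=> mf f0.
have GO : <<s past t>> `<=` measurable.
  by rewrite past_id; exact: past_measurable.
have lawE (H : set Om) (A : set (measurableTypeR R)) :
    <<s past t>> H -> measurable A ->
    (P (H `&` a t @^-1` A) = \int[P]_(w in H)
      \int[uniform_prob (@ltr01 R)]_(y in A) ((fun=> 1%R) (w, y))%:E)%E.
  rewrite past_id => pH mA; rewrite (run_a run tT pH mA).
  rewrite (eq_integral (fun=> uniform_prob (@ltr01 R) A)); last first.
    by move=> w _; rewrite (integral_cst _ mA) mul1e.
  rewrite (integral_cst _ (past_measurable tT2 pH)).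
  exact: muleC.
have ma : measurable_fun setT (a t : Om -> measurableTypeR R).
  exact: (run_measurable_a run tT).
have m1 : measurable_fun setT (fun _ : OmP * measurableTypeR R => 1 : R).
  exact: measurable_cst.
rewrite (integral_conditional_density GO ma m1 (fun=> ler01) lawE mf f0).
apply: eq_integral => w _.
rewrite (eq_integral (fun s => f (w, s))); last by move=> s _; rewrite mule1.
rewrite integral_uniform//; first by rewrite subr0 invr1 mul1e.
exact: (measurable_fun_pair2 (f := f)).
Qed.

Lemma sample_density_gt0 :
  P.-negligible [set w | ~ 0 < p (query a x t w) (z t w)].
Proof.
pose f (e : OmA * Z) : \bar R :=
  (if 0 < p (query a x t e.1) e.2 then 0 else 1)%:E.
have mf : measurable_fun setT f.
  apply/measurable_EFinP; apply: measurable_fun_ifT => //.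
  apply: measurable_fun_ltr => //.
  apply: (measurable_feasible_comp (f := fun xz => p xz.1 xz.2)).
  - exact: (wp_measurable_p wp).
  - move=> i; exact: (measurableT_comp (measurable_query i) measurable_fst).
  - exact: measurable_snd.
  - by move=> e; exact: query_in.
have f0 e : (0 <= f e)%E by rewrite /f lee_fin; case: ifP.
have int0 : (\int[P]_w f (w, z t w) = 0)%E.
  rewrite expect_sample// integral0_eq// => w _.
  rewrite integral0_eq// => y _; rewrite /f /=; case: ltP => [_|p0].
    by rewrite mul0e.
  have -> : p (query a x t w) y = 0.
    by apply/eqP; rewrite eq_le p0 density_ge0//; exact: query_in.
  by rewrite mule0.
have mz : measurable_fun setT (z t).
  by apply: (run_measurable_z run); case/andP: tT => /ltnW -> ->.
have mid : measurable_fun setT (id : Om -> OmA).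
  move=> _ H; rewrite setTI => pH; apply: (past_and_a_measurable tT).
  by rewrite -past_and_a_id.
have mfz : measurable_fun setT (fun w => f (w, z t w)).
  have mp : measurable_fun setT (fun w : Om => (w : OmA, z t w)).
    exact: measurable_fun_pair.
  exact: (measurableT_comp mf mp).
have : ae_eq P setT (fun w => f (w, z t w)) (cst 0%E).
  apply/(ae_eq_integral_abs P measurableT mfz).
  by rewrite -[RHS]int0; apply: eq_integral => w _; rewrite gee0_abs.
apply: negligibleS => w /= pw; apply/not_implyP; split => //.
by rewrite /f /=; case: ifP => // _ /eqP; rewrite onee_eq0.
Qed.

End conditional_laws.

(** The sample is integrated out given the query point, then the query point is
    integrated out given the past. *)
Lemma error_step n (rho : R) : (n.+2 <= T)%N -> rho = n.+1%:R^-1 ->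
  (\int[P]_w (enorm (error n.+1 w) ^+ 2)%:E <=
   \int[P]_w (
    (1 - rho) ^+ 2 * enorm (error n w) ^+ 2
    + 2 * rho * (1 - rho) * enorm (error n w) * (LF + Lbar)
        * enorm (x n.+2 w - x n.+1 w)
    + 8 * rho ^+ 2 * GF ^+ 2
    + 2 * (1 - rho) ^+ 2 * Lbar2 * enorm (x n.+2 w - x n.+1 w) ^+ 2)%:E)%E.
Proof.
move=> nT rhoE; set t := n.+2.
have tT : (2 <= t <= T)%N by [].
pose OmP := g_sigma_algebraType (past t).
pose OmA := g_sigma_algebraType (past_and_a t).
have KX w : K (x t w) by apply: iterate_in; rewrite /= leqW.
have KX' w : K (x n.+1 w) by apply: iterate_in; rewrite /= ltnW// leqW.
pose q (ws : OmP * measurableTypeR R) :=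
  segment_point (x t ws.1) (x n.+1 ws.1) ws.2.
have Kq ws : K (q ws) by exact: segment_pointK.
pose err (e : (OmP * measurableTypeR R) * Z) :=
  next_error rho (x t e.1.1) (x n.+1 e.1.1) (error n e.1.1) (q e.1) e.2.
have past_comp (f : OmP -> 'cV[R]_d) : measurable_vec setT f ->
    measurable_vec setT (fun e : (OmP * measurableTypeR R) * Z => f e.1.1).
  move=> mf i; apply: (measurableT_comp (mf i)).
  exact: (measurableT_comp measurable_fst measurable_fst).
have mq : measurable_vec setT (fun e : (OmP * measurableTypeR R) * Z => q e.1).
  by move=> i; exact: (measurableT_comp (measurable_segment tT i) measurable_fst).
have merr : measurable_vec setT err.
  apply: measurable_next_error => //.
  - by apply: past_comp; apply: measurable_iterate; [rewrite /= leqnn|exact: leqW].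
  - apply: past_comp; apply: measurable_iterate; first by rewrite /= leqnSn.
    by rewrite ltnW// leqW.
  - by apply: past_comp; apply: measurable_error => //; exact: ltnW.
pose f e : \bar R := (enorm (err e) ^+ 2)%:E.
have mf : measurable_fun setT f.
  apply/measurable_EFinP; under eq_fun do rewrite enorm_sqr.
  exact: measurable_inner.
have f0 e : (0 <= f e)%E by rewrite lee_fin sqr_ge0.
have mk : measurable_fun setT
    (fun e : (OmP * measurableTypeR R) * Z => p (q e.1) e.2).
  apply: (measurable_feasible_comp (f := fun xz => p xz.1 xz.2)) => //.
    exact: (wp_measurable_p wp).
  by move=> e; exact: Kq.
pose fk e : \bar R := (f e * (p (q e.1) e.2)%:E)%E.
have mfk : measurable_fun setT fk.
  by apply: (emeasurable_funM mf); apply/measurable_EFinP; exact: mk.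
have fk0 e : (0 <= fk e)%E by rewrite mule_ge0 ?f0// lee_fin density_ge0// Kq.
pose I ws := (\int[mu]_y fk (ws, y))%E.
have mI : measurable_fun setT I.
  exact: (measurable_fun_fubini_tonelli_F _ mfk fk0).
have I0 ws : (0 <= I ws)%E by exact: integral_ge0.
have qE w : query a x t w = q (w, a t w) by rewrite query_segment.
have mpair : measurable_fun setT
    (fun e : OmA * Z => ((e.1 : OmP, a t e.1 : measurableTypeR R), e.2)).
  apply: measurable_fun_pair; last exact: measurable_snd.
  apply: measurable_fun_pair.
    exact: (measurableT_comp (@measurable_id_past t) measurable_fst).
  exact: (measurableT_comp (@measurable_a_past_and_a t) measurable_fst).
pose fA (e : OmA * Z) : \bar R := f ((e.1, a t e.1), e.2).
have mfA : measurable_fun setT fA by exact: (measurableT_comp mf mpair).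
have fA0 e : (0 <= fA e)%E by exact: f0.
have -> : (\int[P]_w (enorm (error n.+1 w) ^+ 2)%:E =
    \int[P]_w \int[lebesgue_measure]_(s in `[(0%R : R), 1%R]) I (w, s))%E.
  transitivity (\int[P]_w fA (w, z t w))%E.
    by apply: eq_integral => w _; rewrite /fA /f /err /= -rhoE qE.
  rewrite (expect_sample tT mfA fA0).
  transitivity (\int[P]_w I (w, a t w))%E.
    by apply: eq_integral => w _; rewrite qE.
  exact: (expect_uniform tT mI I0).
apply: ge0_le_integral_any => w; first exact: integral_ge0.
have n1 : (1 : R) <= n.+1%:R by rewrite ler1n.
have rho01 : 0 <= rho <= 1 by rewrite rhoE invr_ge0 ler0n invf_le1 ?ltr0n.
apply: le_trans (mean_next_error_le (error n w) rho01 (KX w) (KX' w)).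
rewrite le_eqVlt; apply/orP; left; apply/eqP.
apply: eq_integral => s _; apply: eq_integral => y _.
by rewrite EFinM.
Qed.

Variable C : R.
Hypothesis C1 : 4 * (2 * G + rad * Lbar) ^+ 2 <= C.
Hypothesis C2 : 256 <= C.
Hypothesis C3 : (2 * rad * (Lbar + L)) ^+ 4 <= C.

Let rad0 : 0 <= rad. Proof. exact: le_trans (enorm_ge0 _) (Krad K0). Qed.
Let GF0 : 0 <= GF. Proof. exact: le_trans (enorm_ge0 _) (gradGF point K0). Qed.
Let LF0 : 0 <= LF.
Proof. exact: le_trans (spectral_norm_ge0 _) (hessLF point K0). Qed.
Let GFG : GF <= G. Proof. by rewrite le_max lexx. Qed.
Let LFL : LF <= L. Proof. by rewrite le_max lexx. Qed.
Let Lbar0 : 0 <= Lbar. Proof. exact: sqrtr_ge0. Qed.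
Let LbarE : Lbar ^+ 2 = Lbar2. Proof. exact: sqr_sqrtr Lbar2_ge0. Qed.

(** The last two lower bounds on [C] combine into a bound on the square of the
    bias constant, because the square root of [C] is at most [C / 16] when
    [256 <= C]. *)
Lemma bias_constant_le : (rad * (LF + Lbar)) ^+ 2 <= C / 64.
Proof.
move: LFL Lbar0 C3 => LFL' Lb0; move: Lbar Lb0 => Lb Lb0.
move: L LFL' => L' LFL' C3'.
have k0 : 0 <= rad * (LF + Lb) by rewrite mulr_ge0// addr_ge0.
have kk : rad * (LF + Lb) <= rad * (Lb + L').
  by rewrite ler_wpM2l// addrC lerD2l.
have k4 : (rad * (LF + Lb)) ^+ 4 <= (rad * (Lb + L')) ^+ 4.
  by rewrite lerXn2r ?nnegrE ?(le_trans k0).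
have k4C : 16 * (rad * (LF + Lb)) ^+ 4 <= C.
  have : (2 * rad * (Lb + L')) ^+ 4 = 16 * (rad * (Lb + L')) ^+ 4 by ring.
  by move: C3' => /[swap] -> C3'; lra.
have C0 : 0 <= C by move: C2; lra.
move: (rad * (LF + Lb)) k0 k4C => k k0 k4C.
rewrite -(ler_pXn2r (n := 2))// ?nnegrE ?sqr_ge0 ?divr_ge0//.
have -> : (k ^+ 2) ^+ 2 = k ^+ 4 by ring.
have := C2; nra.
Qed.

(** The terms that do not involve the previous error are bounded by
    [rho ^+ 2 * C / 2]: both the step length, at most [rad * rho], and the weight
    of the new stochastic gradient carry a factor [rho]. *)
Lemma error_step_le n (rho : R) : (n.+2 <= T)%N -> rho = n.+1%:R^-1 ->
  (\int[P]_w (enorm (error n.+1 w) ^+ 2)%:E <=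
   \int[P]_w (((1 - rho) ^+ 2 + (1 - rho) * rho ^+ 2 / 8)
       * enorm (error n w) ^+ 2
     + ((1 - rho) * rho ^+ 2 / 8 + rho ^+ 2 / 2) * C)%:E)%E.
Proof.
move=> nT rhoE; apply: le_trans (error_step nT rhoE) _.
have n1 : (1 : R) <= n.+1%:R by rewrite ler1n.
have /andP[rho0 rho1] : 0 <= rho <= 1.
  by rewrite rhoE invr_ge0 ler0n invf_le1 ?ltr0n.
have bias := bias_constant_le.
apply: ge0_le_integral_any => w; rewrite lee_fin.
  move: Lbar2_ge0 Lbar0; move: Lbar => Lb; move: Lbar2 => Lb2 Lb20 Lb0.
  by rewrite !addr_ge0 ?mulr_ge0 ?sqr_ge0 ?enorm_ge0 ?subr_ge0 ?addr_ge0.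
have h0 := enorm_ge0 (x n.+2 w - x n.+1 w).
have hrho : enorm (x n.+2 w - x n.+1 w) <= rad * rho.
  have nT' : (2 <= n.+2 <= T)%N by [].
  rewrite (le_trans (step_size w nT'))// ler_wpM2l// rhoE.
  by rewrite lef_pV2 ?posrE ?ltr0n// ler_nat ltnW.
have e0 := enorm_ge0 (error n w).
move: (enorm (error n w)) (enorm (x n.+2 w - x n.+1 w)) e0 h0 hrho.
move=> e h e0 h0 hrho.
have c0 : 0 <= 2 * rho * (1 - rho) * e by rewrite !mulr_ge0// subr_ge0.
have h2 : h ^+ 2 <= (rad * rho) ^+ 2 by rewrite lerXn2r ?nnegrE ?(le_trans h0).
have cross : 2 * rho * (1 - rho) * e * (LF + Lbar) * h <=
    (1 - rho) * rho ^+ 2 * (e ^+ 2 / 8 + C / 8).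
  have s1 : (LF + Lbar) * h <= rho * (rad * (LF + Lbar)).
    have -> : rho * (rad * (LF + Lbar)) = (LF + Lbar) * (rad * rho) by ring.
    by rewrite ler_wpM2l// addr_ge0.
  (* the weight 8 balances the coefficient of [e ^+ 2], which must not exceed
     what the contraction gains, against the constant [C / 8] that is left *)
  have s2 : 2 * e * (rad * (LF + Lbar)) <= e ^+ 2 / 8 + C / 8.
    by move: bias (sqr_ge0 (e - 8 * (rad * (LF + Lbar)))); lra.
  rewrite -mulrA; apply: le_trans (ler_wpM2l c0 s1) _.
  have -> : 2 * rho * (1 - rho) * e * (rho * (rad * (LF + Lbar))) =
      (1 - rho) * rho ^+ 2 * (2 * e * (rad * (LF + Lbar))) by ring.
  by rewrite ler_wpM2l// mulr_ge0 ?sqr_ge0// subr_ge0.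
have var : 8 * rho ^+ 2 * GF ^+ 2 + 2 * (1 - rho) ^+ 2 * Lbar2 * h ^+ 2 <=
    rho ^+ 2 * (C / 2).
  have Lbar20 := Lbar2_ge0.
  have s1 : (1 - rho) ^+ 2 * (Lbar2 * h ^+ 2) <= Lbar2 * (rad * rho) ^+ 2.
    rewrite -[leRHS]mul1r ler_pM ?sqr_ge0 ?mulr_ge0 ?sqr_ge0//; last first.
      by rewrite ler_wpM2l.
    by rewrite expr_le1// ?subr_ge0// gerBl.
  have s2 : 8 * GF ^+ 2 + 2 * Lbar2 * rad ^+ 2 <= C / 2.
    move: C1 LbarE Lbar0 GFG; move: Lbar2 Lbar => Lb2 Lb C1' <- Lb0 GFG'.
    have G2 : GF ^+ 2 <= G ^+ 2 by rewrite lerXn2r ?nnegrE ?(le_trans GF0).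
    have rL : 0 <= rad * Lb by exact: mulr_ge0.
    have GrL : 0 <= G * (rad * Lb) by rewrite mulr_ge0// (le_trans GF0).
    lra.
  have := ler_wpM2l (sqr_ge0 rho) s2; lra.
lra.
Qed.

Lemma measurable_error_sqr n : (n < T)%N ->
  measurable_fun setT (fun w => (enorm (error n w) ^+ 2)%:E).
Proof.
move=> nT; apply/measurable_EFinP.
have GO : <<s past n.+2>> `<=` measurable.
  by rewrite past_id; exact: past_measurable.
apply: (measurable_fun_sub_ambient GO); under eq_fun do rewrite enorm_sqr.
by apply: measurable_inner; exact: measurable_error.
Qed.

(** With [rho = 1 / n.+1], the first factor contracts the mean square by about
    [1 - 2 * rho], a gain of [2 * C * rho ^+ 2]; going from [C / n.+1] to
    [C / n.+2] only requires a gain of about [C * rho ^+ 2], which leaves room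
    for the constants. In the first step [rho = 1] and only [C / 2] remains. *)
Lemma mean_sqr_error_le n : (n < T)%N ->
  (\int[P]_w (enorm (error n w) ^+ 2)%:E <= (C / n.+1%:R)%:E)%E.
Proof.
have C0 : 0 <= C by move: C2; lra.
elim: n => [T0'|n ih nT].
  have -> : (C / 1%:R)%:E = (\int[P]_w (C / 1%:R)%:E)%E.
    by rewrite integral_probability_cst.
  apply: ge0_le_integral_any => w; rewrite lee_fin ?sqr_ge0// divr1.
  have K1 : K (x 1%N w) by exact: iterate_in.
  have := le_trans (ler_enormB _ _) (lerD (gradGF (z 1%N w) K1)
    (enorm_grad_objective K1)).
  have := enorm_ge0 (grad_Ft Ft (x 1%N w) (z 1%N w) - grad F (x 1%N w)).
  rewrite -/(error 0 w); move: (enorm (error 0 w)) => t t0 tG.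
  apply: le_trans C1; move: Lbar Lbar0 GFG => Lb Lb0 GFG'.
  have rL : 0 <= rad * Lb by exact: mulr_ge0.
  have : t <= 2 * (2 * G + rad * Lb) by move: GF0; lra.
  move: (2 * G + rad * Lb) => s ts; nra.
set rho : R := n.+1%:R^-1.
apply: le_trans (error_step_le nT erefl) _; rewrite -/rho.
have n1 : (1 : R) <= n.+1%:R by rewrite ler1n.
have /andP[rho0 rho1] : 0 <= rho <= 1.
  by rewrite /rho invr_ge0 ler0n invf_le1 ?ltr0n.
have a0 : 0 <= (1 - rho) ^+ 2 + (1 - rho) * rho ^+ 2 / 8.
  by rewrite addr_ge0 ?sqr_ge0// divr_ge0// mulr_ge0 ?sqr_ge0// subr_ge0.
have b0 : 0 <= (1 - rho) * rho ^+ 2 / 8 + rho ^+ 2 / 2.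
  by rewrite addr_ge0 ?divr_ge0 ?mulr_ge0 ?sqr_ge0// subr_ge0.
under eq_integral do rewrite EFinD EFinM.
rewrite ge0_integralD//; last 3 first.
- by move=> w _; rewrite mule_ge0// lee_fin ?sqr_ge0.
- apply: emeasurable_funM => //; apply: measurable_error_sqr; exact: ltnW.
- by move=> w _; rewrite lee_fin mulr_ge0.
rewrite ge0_integralZl//; last 2 first.
- by apply: measurable_error_sqr; exact: ltnW.
- by move=> w _; rewrite lee_fin sqr_ge0.
rewrite integral_probability_cst.
apply: le_trans (leeD2r _ (lee_wpmul2l _ (ih (ltnW nT)))) _.
  by rewrite lee_fin.
rewrite -EFinM -EFinD lee_fin.
have -> : (n.+2%:R : R)^-1 = (rho^-1 + 1)^-1 by rewrite invrK natr1.
have rhop : 0 < rho by rewrite invr_gt0 ltr0n.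
have -> : (rho^-1 + 1)^-1 = rho / (1 + rho).
  have -> : rho^-1 + 1 = (1 + rho) / rho by rewrite mulrDl mul1r divff// gt_eqF.
  by rewrite invf_div.
rewrite -/rho mulrA ler_pdivlMr ?addr_gt0//.
suff : ((1 - rho) ^+ 2 + (1 - rho) * rho ^+ 2 / 8) * (rho * (1 + rho))
    + ((1 - rho) * rho ^+ 2 / 8 + rho ^+ 2 / 2) * (1 + rho) <= rho.
  move/(ler_wpM2l C0); lra.
have : 0 <= rho ^+ 2 * (1 - rho) by rewrite mulr_ge0 ?sqr_ge0 ?subr_ge0.
have : 0 <= rho ^+ 3 * (1 - rho) by rewrite mulr_ge0 ?exprn_ge0 ?subr_ge0.
have : 0 <= rho ^+ 3 * (1 - rho) ^+ 2 by rewrite mulr_ge0 ?exprn_ge0 ?subr_ge0.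
lra.
Qed.


(** * The optimality gap *)

Hypothesis monF : monotone_orthant F.
Hypothesis DRF : DR_submodular F.
Variable xstar : 'cV[R]_d.
Hypothesis xstarP : is_argmax K F xstar.

Let Tp : (0 : R) < T%:R. Proof. by rewrite ltr0n. Qed.

(** The direction [v] does at least as well as [xstar] against the estimated
    gradient; replacing the estimate by the gradient costs at most the error
    times [2 * rad], a bound on the diameter of [K]. *)
Lemma gap_step n w : (n < T)%N ->
  (forall t, (2 <= t <= T)%N -> 0 < p (query a x t w) (z t w)) ->
  F xstar - F (x n.+2 w) <=
  (1 - T%:R^-1) * (F xstar - F (x n.+1 w))
  + T%:R^-1 * (2 * rad * enorm (error n w))
  + Lbar / 2 * (T%:R^-1 * rad) ^+ 2.
Proof.
move=> nT pos; have nT' : (1 <= n.+1 <= T)%N by [].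
have [Ks _] := xstarP.
have [Kv vmax] := run_v run w nT'.
have KX : K (x n.+1 w) by apply: iterate_in; rewrite /= ltnW// ltnS.
have KY : K (x n.+2 w) by apply: iterate_in.
have eta0 : 0 <= T%:R^-1 :> R by rewrite invr_ge0 ltW.
have := vmax _ Ks; rewrite /= => {}vmax.
have err := gradient_error nT pos.
have gap := DR_gap_le DRF monF (KO KX) (KO Ks).
have vrad : enorm (T%:R^-1 *: v n.+1 w) <= T%:R^-1 * rad.
  by rewrite enormZ ger0_norm// ler_wpM2l// Krad.
move: KY; rewrite (run_x run w nT') => KY.
have smooth := smooth_lower_bound convK F2 Lbar0
  (fun y h Ky => enorm_hess_objective h Ky) KX KY.
move: smooth; rewrite innerZr => smooth.
have e0 := enorm_ge0 (error n w).
have cs1 : inner (error n w) (v n.+1 w - xstar) <= 2 * rad * enorm (error n w).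
  rewrite mulrC (le_trans (cauchy_schwarz _ _))// ler_wpM2l//.
  by rewrite (le_trans (ler_enormB _ _))// mulrDl mul1r lerD// Krad.
have lin : F xstar - F (x n.+1 w) - 2 * rad * enorm (error n w)
    <= inner (grad F (x n.+1 w)) (v n.+1 w).
  move: cs1 vmax gap; rewrite -err !inner_simpl (innerC xstar) (innerC (v _ _)).
  lra.
have sq : enorm (T%:R^-1 *: v n.+1 w) ^+ 2 <= (T%:R^-1 * rad) ^+ 2.
  by rewrite lerXn2r ?nnegrE ?enorm_ge0 ?mulr_ge0.
have s1 := ler_wpM2l eta0 lin.
have L2 : 0 <= Lbar / 2 by rewrite divr_ge0.
have s2 := ler_wpM2l L2 sq.
move: s1 s2 smooth {err vmax vrad gap cs1 lin sq}.
move: (F (x n.+1 w + _)) => Fy.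
move: (F (x n.+1 w)) (F xstar) (enorm (error n w)) e0 => Fx Fs e e0.
move: (inner _ _) (enorm _) => i h.
move: Lbar (T%:R^-1) L2 eta0 => Lb eta L2 eta0 s1 s2 smooth.
lra.
Qed.

Lemma gap_le n w : (n <= T)%N ->
  (forall t, (2 <= t <= T)%N -> 0 < p (query a x t w) (z t w)) ->
  F xstar - F (x n.+1 w) <=
  (1 - T%:R^-1) ^+ n * (F xstar - F (x 1%N w))
  + T%:R^-1 * (2 * rad) * \sum_(i < n) enorm (error i w)
  + n%:R * (Lbar / 2 * (T%:R^-1 * rad) ^+ 2).
Proof.
move=> + pos; elim: n => [_|n ih nT].
  by rewrite big_ord0 expr0 mul1r mulr0 mul0r !addr0.
have eta1 : T%:R^-1 <= 1 :> R by rewrite invf_le1// ler1n.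
have eta0 : 0 <= T%:R^-1 :> R by rewrite invr_ge0 ltW.
apply: le_trans (gap_step nT pos) _.
rewrite big_ord_recr/= -[n.+1%:R]natr1.
have L2 : 0 <= Lbar / 2 * (T%:R^-1 * rad) ^+ 2.
  by rewrite mulr_ge0 ?sqr_ge0// divr_ge0.
have n0 : 0 <= n%:R * (Lbar / 2 * (T%:R^-1 * rad) ^+ 2) by rewrite mulr_ge0.
have S0 : 0 <= T%:R^-1 * (2 * rad) * \sum_(i < n) enorm (error i w).
  by rewrite !mulr_ge0// sumr_ge0// => i _; exact: enorm_ge0.
have e1 : 0 <= 1 - T%:R^-1 :> R by rewrite subr_ge0.
rewrite (exprS _ n) -[(1 - _) * _ * (F _ - _)]mulrA.
have := ler_wpM2l e1 (ih (ltnW nT)).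
move: L2 n0; move: (Lbar / 2 * _) => l2 L2 n0.
move: S0; move: (\sum_(i < n) _) (enorm (error n w)) => S e S0.
move: (F xstar - F (x n.+1 w)) ((1 - _) ^+ n * (F xstar - _)) => dn q.
move: (T%:R^-1) eta0 e1 S0 (n%:R : R) n0 {eta1} => eta eta0 e1 S0 N n0 ihn.
have := mulr_ge0 eta0 n0; have := mulr_ge0 eta0 S0.
lra.
Qed.

Lemma measurable_objective_iterate :
  measurable_fun setT (fun w => F (x T.+1 w)).
Proof.
have [_ _ dF _] := DRF.
have mF : measurable_fun (K : set (borel_cV R d)) (F : borel_cV R d -> R).
  apply: measurable_fun_continuous_on => y Ky.
  exact/differentiable_continuous/dF/KO.
have mx : measurable_vec setT (x T.+1 : Om -> 'cV[R]_d).
  move=> i; have GO : <<s past T.+1>> `<=` measurable.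
    by rewrite past_id; exact: past_measurable.
  apply: (measurable_fun_sub_ambient GO).
  by apply: measurable_iterate; rewrite /= leqnn.
have xK : (x T.+1 : Om -> borel_cV R d) @` setT `<=` K.
  by move=> _ [w _ <-]; apply: iterate_in; rewrite /= leqnn.
exact: (measurable_comp mK xK mF (measurable_fun_borel mx)).
Qed.

(** The norm of the error [e] enters the gap, while its square is controlled; the
    two are related by [2 * e <= e ^+ 2 / b + b], where [b] is the square root of
    the bound on the mean square. *)
Lemma sfw_bound :
  ('E_P[fun w => F (x T.+1 w)] >=
     ((1 - expR (-1)) * F xstar - 4 * rad * Num.sqrt C / Num.sqrt T%:R
      - Lbar * rad ^+ 2 / (2 * T%:R))%:E)%E.
Proof.
have [_ F0 _ _] := DRF; have [Ks _] := xstarP.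
have Cp : 0 < C by move: C2; lra.
pose b (i : nat) : R := Num.sqrt C / Num.sqrt i.+1%:R.
have b0 i : 0 < b i by rewrite divr_gt0 ?sqrtr_gt0 ?ltr0n.
have bsqr i : b i ^+ 2 = C / i.+1%:R.
  by rewrite exprMn exprVn !sqr_sqrtr ?ler0n// ltW.
pose r : R := T%:R^-1 * rad.
have r0 : 0 <= r by rewrite mulr_ge0// invr_ge0 ltW.
pose S w := \sum_(i < T) r / b i * enorm (error i w) ^+ 2.
pose k := r * \sum_(i < T) b i + Lbar * rad ^+ 2 / (2 * T%:R).
have Fs0 : 0 <= F xstar by exact/F0/KO.
have FT0 w : 0 <= F (x T.+1 w).
  by apply/F0/KO/iterate_in; rewrite /= leqnn.
have rb0 i : 0 <= r / b i by rewrite divr_ge0// ltW.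
have S0 w : 0 <= S w by apply: sumr_ge0 => i _; rewrite mulr_ge0 ?sqr_ge0.
have sumb0 : 0 <= \sum_(i < T) b i by apply: sumr_ge0 => i _; exact: ltW.
have k0 : 0 <= k.
  by rewrite addr_ge0 ?mulr_ge0 ?sqr_ge0 ?invr_ge0 ?mulr_ge0// ltW.
have good : {ae P, forall w t, (2 <= t <= T)%N ->
    0 < p (query a x t w) (z t w)}.
  apply: ae_foralln => t; have [tT|/negP tT] := boolP (2 <= t <= T)%N.
    by apply: negligibleS (sample_density_gt0 tT) => w /= npw pw; exact: npw.
  by apply: aeW => w tT'; exfalso; exact: tT.
have pathwise w : (forall t, (2 <= t <= T)%N ->
    0 < p (query a x t w) (z t w)) ->
  (1 - expR (-1)) * F xstar <= F (x T.+1 w) + S w + k.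
  move=> pos; have := gap_le (leqnn T) pos.
  have e1 : T%:R^-1 * (2 * rad) * \sum_(i < T) enorm (error i w)
      <= S w + r * \sum_(i < T) b i.
    rewrite /S !mulr_sumr -big_split; apply: ler_sum => i _ /=.
    have -> : T%:R^-1 * (2 * rad) * enorm (error i w) =
        r * (2 * enorm (error i w)) by rewrite /r; ring.
    rewrite -[r / b i * _]mulrA -mulrDr ler_wpM2l//.
    have bi := b0 i; rewrite -(ler_pM2l bi) mulrDr mulVKf ?gt_eqF//.
    by have := sqr_ge0 (enorm (error i w) - b i); lra.
  have e2 : T%:R * (Lbar / 2 * (T%:R^-1 * rad) ^+ 2) =
      Lbar * rad ^+ 2 / (2 * T%:R).
    by field; rewrite gt_eqF.
  have e3 : (1 - T%:R^-1) ^+ T * (F xstar - F (x 1%N w))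
      <= expR (-1) * F xstar.
    have q0 : 0 <= (1 - T%:R^-1 : R) ^+ T.
      by rewrite exprn_ge0// subr_ge0 invf_le1// ler1n.
    have F1 : 0 <= F (x 1%N w) by apply/F0/KO/iterate_in.
    apply: le_trans (ler_wpM2r Fs0 (onem_inv_exp_le R T0)).
    by rewrite ler_wpM2l// gerBl.
  rewrite e2 /k; lra.
have mS : measurable_fun setT S.
  apply: measurable_sum => i; apply: measurable_funM => //.
  exact/measurable_EFinP/measurable_error_sqr.
have mFT := measurable_objective_iterate.
have intS : (\int[P]_w (S w)%:E <= (r * \sum_(i < T) b i)%:E)%E.
  under eq_integral do rewrite -sumEFin.
  rewrite ge0_integral_sum//; last 2 first.
  - move=> i; apply/measurable_EFinP; apply: measurable_funM => //.
    exact/measurable_EFinP/measurable_error_sqr.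
  - by move=> i w _; rewrite lee_fin mulr_ge0 ?sqr_ge0.
  rewrite mulr_sumr -sumEFin; apply: lee_sum => i _.
  have rbE : (0 <= (r / b i)%:E)%E by rewrite lee_fin.
  under eq_integral do rewrite EFinM.
  rewrite ge0_integralZl//; last 2 first.
  - exact: measurable_error_sqr.
  - by move=> w _; rewrite lee_fin sqr_ge0.
  apply: le_trans (lee_wpmul2l rbE (mean_sqr_error_le (ltn_ord i))) _.
  by rewrite -EFinM lee_fin -bsqr expr2 mulrA divfK ?gt_eqF.
have intall : (\int[P]_w (F (x T.+1 w) + S w + k)%:E
    <= 'E_P[fun w => F (x T.+1 w)] + (r * \sum_(i < T) b i)%:E + k%:E)%E.
  under eq_integral do rewrite EFinD.
  rewrite ge0_integralD//; last 2 first.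
  - by move=> w _; rewrite lee_fin addr_ge0.
  - by apply/measurable_EFinP; exact: measurable_funD.
  rewrite integral_probability_cst leeD2r//.
  under eq_integral do rewrite EFinD.
  rewrite ge0_integralD//; last 4 first.
  - by move=> w _; rewrite lee_fin.
  - exact/measurable_EFinP.
  - by move=> w _; rewrite lee_fin.
  - exact/measurable_EFinP.
  by rewrite unlock leeD2l.
have : (((1 - expR (-1)) * F xstar)%:E
    <= 'E_P[fun w => F (x T.+1 w)] + (r * \sum_(i < T) b i)%:E + k%:E)%E.
  apply: le_trans intall; rewrite -(integral_probability_cst P).
  have e1 : 0 <= 1 - expR (-1) :> R.
    have : expR (-1) <= expR 0 :> R by rewrite ler_expR lerN10.
    by rewrite expR0 subr_ge0.
  apply: ae_ge0_le_integral => //.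
  - by move=> w _; rewrite lee_fin mulr_ge0.
  - by move=> w _; rewrite lee_fin; apply: addr_ge0 => //; exact: addr_ge0.
  - apply/measurable_EFinP; apply: measurable_funD => //.
    exact: measurable_funD.
  - by apply: filterS good => w pos _; rewrite lee_fin pathwise.
rewrite -addeA -EFinD -leeBlDr//; apply: le_trans.
rewrite -EFinB lee_fin /k.
have sumb : \sum_(i < T) b i <= 2 * Num.sqrt C * Num.sqrt T%:R.
  rewrite /b -mulr_sumr -mulrA mulrCA ler_wpM2l ?sqrtr_ge0//.
  exact: sum_inv_sqrt_le.
have : 2 * r * \sum_(i < T) b i <= 4 * rad * Num.sqrt C / Num.sqrt T%:R.
  have r2 : 0 <= 2 * r by rewrite mulr_ge0.
  apply: le_trans (ler_wpM2l r2 sumb) _.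
  have sT : 0 < Num.sqrt T%:R :> R by rewrite sqrtr_gt0.
  have -> : r = rad / Num.sqrt T%:R ^+ 2.
    by rewrite sqr_sqrtr ?ltW// mulrC.
  rewrite le_eqVlt; apply/orP; left; apply/eqP.
  by field; rewrite gt_eqF.
lra.
Qed.


End sfw.

Theorem theorem3 (R : realType) (d : nat)
    (dZ : measure_display) (Z : measurableType dZ)
    (mu : {sigma_finite_measure set Z -> \bar R})
    (p Ft : 'cV[R]_d -> Z -> R) (K : set 'cV[R]_d)
    (rad B GF Gp LF Lp : R)
    (dO : measure_display) (Om : measurableType dO) (P : probability Om R)
    (T : nat) (a : nat -> Om -> R) (z : nat -> Om -> Z)
    (x g v : nat -> Om -> 'cV[R]_d) (xstar : 'cV[R]_d) :
  let F := objective mu p Ft in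
  let G : R := Num.max GF Gp in
  let L : R := Num.max LF Lp in
  let Lbar : R := Num.sqrt (4 * B ^+ 2 * G ^+ 4 + 16 * G ^+ 4 + 4 * L ^+ 2
                        + 4 * B ^+ 2 * L ^+ 2) in
  let C : R := Num.max (4 * (2 * G + rad * Lbar) ^+ 2)
             (Num.max 256 ((2 * rad * (Lbar + L)) ^+ 4)) in
  K `<=` orthant ->
  convex_set K ->
  well_posed mu p Ft K ->
  (* gradient and Hessian estimators are unbiased *)
  (forall y, K y -> mx_expect mu p y (grad_Ft Ft y) = grad F y) ->
  (forall y, K y -> twice_differentiable F y /\
     mx_expect mu p y (hess_est p Ft y) = hess F y) ->
  (* (A1) *)
  compact K -> is_radius K rad ->
  (* (A2) *)
  (forall y s, K y -> `|Ft y s| <= B) ->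
  (* (A3) *)
  (forall y s, K y -> enorm (grad_Ft Ft y s) <= GF) ->
  0 <= Gp ->
  (forall y, K y ->
     (moment mu p y (fun s => enorm (score p y s) ^+ 4)%R <= (Gp ^+ 4)%:E)%E) ->
  (* (A4) *)
  (forall y s, K y -> spectral_norm (hess_Ft Ft y s) <= LF) ->
  0 <= Lp ->
  (forall y, K y ->
     (moment mu p y (fun s => spectral_norm (hess_log p y s) ^+ 2)%R
        <= (Lp ^+ 2)%:E)%E) ->
  monotone_orthant F ->
  DR_submodular F ->
  (0 < T)%N ->
  K 0 ->
  sfw_run mu p Ft P a z x g v K T
    (fun t => t.-1%:R^-1) (fun=> T%:R^-1) 0 ->
  is_argmax K F xstar ->
  (forall w, K (x T.+1 w)) /\
  ('E_P[fun w => F (x T.+1 w)] >=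
     ((1 - expR (-1)) * F xstar - 4 * rad * Num.sqrt C / Num.sqrt T%:R
      - Lbar * rad ^+ 2 / (2 * T%:R))%:E)%E.
Proof.
move=> F G L Lbar C KO convK wp ug uh cK [_ Krad] FtB gGF Gp0 sGp hLF Lp0 lLp
  monF DRF T0 K0 run xsP.
have mK : measurable (K : set (borel_cV R d)).
  apply: measurable_borel_closed; apply: compact_closed cK.
  exact: norm_hausdorff.
split=> [w|]; first by apply: (iterate_in convK K0 T0 run); rewrite /= leqnn.
apply: (sfw_bound KO mK wp FtB gGF Gp0 sGp hLF Lp0 lLp ug
  (fun y Ky => (uh y Ky).2) convK (fun y Ky => (uh y Ky).1) Krad K0 T0 run
  _ _ _ monF DRF xsP).
- by rewrite le_max lexx.
- by rewrite !le_max lexx orbT.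
- by rewrite !le_max lexx !orbT.
Qed.
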